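(* Let $\Omega\subset\mathbb R^n$ be a bounded domain, $1\le m\le n$, $f:\bar\Omega\times[0,\infty)\to\mathbb R$, and $\varphi$ a function on $(\Omega\times\{0\})\cup(\partial\Omega\times[0,\infty))$. Let $\mathbf f\in C(\bar\Omega)$ and $\Phi\in C(\partial\Omega)$. Assume: (i) $f\ge\nu_m$ for some constant $\nu_m>0$, and $\varphi(\cdot,0)$ is $C^2$ in $\Omega$ with a point $x_0\in\Omega$ such that $\varphi_{xx}(x_0,0)$ is $(m-1)$-positive; (ii) there exists $u\in C^{2,1}(\bar\Omega\times[0,\infty))$ with $E_m[u]=f$ in $\Omega\times(0,\infty)$ and $u=\varphi$ on $(\Omega\times\{0\})\cup(\partial\Omega\times[0,\infty))$; (iii) there exists an $m$-admissible $\mathbf u\in C^2(\bar\Omega)$ with $T_m(\mathbf u_{xx})=\mathbf f$ in $\Omega$ and $\mathbf u=\Phi$ on $\partial\Omega$; (iv) $\sup_{x\in\bar\Omega}|f(x,t)-\mathbf f(x)|\to0$ and $\sup_{x\in\partial\Omega}|\varphi(x,t)-\Phi(x)|\to0$ as $t\to\infty$. Then $\sup_{x\in\bar\Omega}|u(x,t)-\mathbf u(x)|\to0$ as $t\to\infty$.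
   Context: For $S\in\mathrm{Sym}(n)$ and $0\le p\le n$, $T_p(S)$ is the sum of all principal $p\times p$ minors of $S$, with $T_0(S)=1$. For $1\le k\le n$, $K_k=\{S\in\mathrm{Sym}(n):T_p(S)>0,\ p=1,\dots,k\}$; $S$ is $k$-positive if $S\in K_k$; by convention every matrix is $0$-positive. For $u(x,t)$, $u_{xx}$ is its Hessian in $x$ and $E_m[u]=-u_t\,T_{m-1}(u_{xx})+T_m(u_{xx})$. A function $\mathbf u\in C^2(\bar\Omega)$ is $m$-admissible if $\mathbf u_{xx}(x)\in K_m$ for every $x\in\bar\Omega$. *)

(* Defs.v *)
From Stdlib Require Import Reals Lra List Arith.
Import ListNotations.
Open Scope R_scope.

Definition Rn := nat -> R.
Definition in_Rn (n : nat) (x : Rn) : Prop := forall i, (n <= i)%nat -> x i = 0.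

Fixpoint sumR (k : nat) (g : nat -> R) : R :=
  match k with O => 0 | S k' => sumR k' g + g k' end.

Definition normn (n : nat) (x : Rn) : R := sqrt (sumR n (fun i => x i ^ 2)).
Definition distn (n : nat) (x y : Rn) : R := normn n (fun i => x i - y i).

Definition upd (x : Rn) (i : nat) (s : R) : Rn :=
  fun j => if Nat.eqb j i then s else x j.

Definition is_open (n : nat) (A : Rn -> Prop) : Prop :=
  (forall x, A x -> in_Rn n x) /\
  forall x, A x -> exists r, 0 < r /\ forall y, in_Rn n y -> distn n y x < r -> A y.

Definition connected (n : nat) (O : Rn -> Prop) : Prop :=
  forall A B, is_open n A -> is_open n B ->
    (forall x, O x -> A x \/ B x) -> (forall x, O x -> A x -> B x -> False) ->
    (forall x, O x -> A x) \/ (forall x, O x -> B x).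

Definition is_domain (n : nat) (O : Rn -> Prop) : Prop :=
  is_open n O /\ connected n O /\ exists x, O x.

Definition is_bounded (n : nat) (O : Rn -> Prop) : Prop :=
  exists M, forall x, O x -> normn n x <= M.

Definition closure_n (n : nat) (O : Rn -> Prop) (x : Rn) : Prop :=
  in_Rn n x /\ forall r, 0 < r -> exists y, O y /\ distn n y x < r.

Definition boundary_n (n : nat) (O : Rn -> Prop) (x : Rn) : Prop :=
  closure_n n O x /\ ~ O x.

Definition cont_on (n : nat) (S : Rn -> Prop) (g : Rn -> R) : Prop :=
  forall x, S x -> forall eps, 0 < eps -> exists delta, 0 < delta /\
    forall y, S y -> distn n y x < delta -> Rabs (g y - g x) < eps.

Definition cont_on_cyl (n : nat) (S : Rn -> Prop) (g : Rn -> R -> R) : Prop :=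
  forall x t, S x -> 0 <= t -> forall eps, 0 < eps -> exists delta, 0 < delta /\
    forall y s, S y -> 0 <= s -> distn n y x < delta -> Rabs (s - t) < delta ->
      Rabs (g y s - g x t) < eps.

Definition has_partial (g : Rn -> R) (i : nat) (x : Rn) (l : R) : Prop :=
  derivable_pt_lim (fun s => g (upd x i s)) (x i) l.

Definition Mat := nat -> nat -> R.

(* g is C^2 in the open set O, H x is its Hessian (H x i j = d_i d_j g (x)),
   and g, its first and second derivatives extend continuously to S
   (S = O: g in C^2(O);  S = closure_n O: g in C^2(closure_n O)). *)
Definition C2_on (n : nat) (O S : Rn -> Prop) (g : Rn -> R) (H : Rn -> Mat) : Prop :=
  exists Dg : nat -> Rn -> R,
    (forall x i, O x -> (i < n)%nat -> has_partial g i x (Dg i x)) /\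
    (forall x i j, O x -> (i < n)%nat -> (j < n)%nat -> has_partial (Dg j) i x (H x i j)) /\
    cont_on n S g /\
    (forall i, (i < n)%nat -> cont_on n S (Dg i)) /\
    (forall i j, (i < n)%nat -> (j < n)%nat -> cont_on n S (fun x => H x i j)).

(* u in C^{2,1}(closure_n O x [0,oo)), with spatial Hessian H x t and time
   derivative Ut x t, derivatives taken in O x (0,oo) and extended continuously. *)
Definition C21_bar (n : nat) (O : Rn -> Prop) (u : Rn -> R -> R)
    (H : Rn -> R -> Mat) (Ut : Rn -> R -> R) : Prop :=
  exists Du : nat -> Rn -> R -> R,
    (forall x t i, O x -> 0 < t -> (i < n)%nat -> has_partial (fun y => u y t) i x (Du i x t)) /\
    (forall x t i j, O x -> 0 < t -> (i < n)%nat -> (j < n)%nat ->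
        has_partial (fun y => Du j y t) i x (H x t i j)) /\
    (forall x t, O x -> 0 < t -> derivable_pt_lim (fun s => u x s) t (Ut x t)) /\
    cont_on_cyl n (closure_n n O) u /\
    (forall i, (i < n)%nat -> cont_on_cyl n (closure_n n O) (Du i)) /\
    (forall i j, (i < n)%nat -> (j < n)%nat ->
        cont_on_cyl n (closure_n n O) (fun x t => H x t i j)) /\
    cont_on_cyl n (closure_n n O) Ut.

Definition minor (j : nat) (M : Mat) : Mat :=
  fun a b => M (S a) (if Nat.ltb b j then b else S b).

Fixpoint det (k : nat) (M : Mat) : R :=
  match k with
  | O => 1
  | S k' => sumR k (fun j => (-1) ^ j * M O j * det k' (minor j M))
  end.

Fixpoint subsets (l : list nat) (p : nat) : list (list nat) :=
  match l with
  | [] => match p with O => [[]] | _ => [] end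
  | a :: l' => match p with
               | O => [[]]
               | S p' => map (cons a) (subsets l' p') ++ subsets l' p
               end
  end.

Definition principal_minor (I : list nat) (M : Mat) : R :=
  det (length I) (fun a b => M (nth a I O) (nth b I O)).

Definition Tp (n p : nat) (M : Mat) : R :=
  fold_right Rplus 0 (map (fun I => principal_minor I M) (subsets (seq 0 n) p)).

Definition k_positive (n k : nat) (M : Mat) : Prop :=
  forall p, (1 <= p)%nat -> (p <= k)%nat -> 0 < Tp n p M.

Definition Em (n m : nat) (ut : R) (Hx : Mat) : R :=
  - ut * Tp n (m - 1) Hx + Tp n m Hx.

(* Main.v *)
(** The evolution operator is a Hessian operator in one more dimension: [E_m[u] = T_m(Z)] with
    [Z = diag (- u_t, u_xx)]. Everything algebraic rests on one inequality for a symmetric [A] and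
    [B = A + v v^T],
      [T_p(A) T_(p-1)(B) <= T_(p-1)(A) T_p(B)].
    It holds because [det (A + s v v^T + z I)] has no zero with [Im s > 0] and [Im z > 0]; by the
    Gauss-Lucas argument this persists for the [z]-derivatives, whose coefficients at [z = 0] are
    multiples of the [T_p], and for [F + s G] zero-freeness amounts to a nonnegative Wronskian
    [F' G - F G'] at [0]. Consequences: Newton's inequality [T_(p-1) T_(p+1) <= T_p^2], and monotonicity
    of [T_m] on the cone [K_m].

    Since [E_m[u]] is bounded below by a positive constant, Newton's inequality keeps the solution inside
    the cone, starting from [(x0, 0)] and propagating by connectedness. The functions
    [U +- (e (R^2 - |x|^2) + C exp (- lam (t - T)))] are then strict barriers for large [T] and small
    [lam], because [T_m (S + a I) >= T_m (S) + a^m] on the cone, and comparison at the first touching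
    point gives the convergence. *)
Require Import Defs.
From Stdlib Require Import Reals Lra Lia List Arith.
From Stdlib Require Import FunctionalExtensionality Classical IndefiniteDescription.
From Coquelicot Require Derive Compactness.
From mathcomp Require all_boot all_order all_algebra complex polyrcf Rstruct zify ring.
Open Scope R_scope.

(** The solution [u] is not assumed admissible, and the two barriers draw on admissibility
    differently: for the lower one the cone is supplied by the stationary Hessian, for the upper one
    it must come from [u_xx] itself. This is what forces the study of the cone along the evolution.
    For [m >= 2] the sign of [E_m] alone does not place [Z] in [K_m], since [T_m (Z) > 0] also holds
    outside the cone. What helps is that, at admissible points, [E_m >= nu] and a local bound on
    [T_(m-1) (Z)] keep every [T_p (Z)], [p <= m], away from zero, so that limits of admissible
    points are admissible.

    The smoothness classes give coordinatewise derivatives only, and those of [u] only for [t > 0].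
    Hence the symmetry of the Hessian, second derivatives along lines and the Hessian at time 0 are
    derived from partial derivatives and their continuity.

    The constants are fixed in the order [e], [T], [C], [lam]. The gain [a^m] with [a = 2 e] has to
    beat both the error in [f], which determines [T], and the time derivative of the exponential;
    [C] bounds the difference at time [T], so [lam] can only be chosen last. *)

Lemma det_succ k M : det (S k) M = sumR (S k) (fun j => (-1) ^ j * M O j * det k (minor j M)).
Proof. reflexivity. Qed.

(** * Rank-one perturbations of symmetric matrices *)

Module MinorSums.

Import all_boot all_order all_algebra complex polyrcf Rstruct zify ring.
Set Implicit Arguments. Unset Strict Implicit. Unset Printing Implicit Defensive.
Import Order.TTheory GRing.Theory Num.Theory.
Local Open Scope ring_scope.

Definition upper_nonvanishing (C : numClosedFieldType) (p : {poly C}) : Prop :=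
  forall z, 0 < 'Im z -> p.[z] != 0.

Lemma log_deriv_prod (F : fieldType) (r : seq F) (z : F) :
  (forall a, a \in r -> z - a != 0) ->
  let q := \prod_(a <- r) ('X - a%:P) in q^`().[z] / q.[z] = \sum_(a <- r) (z - a)^-1.
Proof.
elim: r => [|a r IH] zr /=; first by rewrite !big_nil derivC horner0 mul0r.
rewrite !big_cons derivM derivXsubC mul1r hornerD !hornerM hornerXsubC.
have za : z - a != 0 by apply: zr; rewrite inE eqxx.
have zr' b : b \in r -> z - b != 0 by move=> br; apply: zr; rewrite inE br orbT.
rewrite -IH //=; set Q := (\prod_(_ <- _) _).
have Qnz : Q.[z] != 0.
  rewrite /Q horner_prod prodf_seq_neq0; apply/allP => b br /=.
  by rewrite hornerXsubC zr'.
by field; rewrite za Qnz.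
Qed.

(** All roots [a] of [p] satisfy [Im a <= 0], so for [Im z > 0] each term of [p'/p = sum 1/(z - a)]
    has negative imaginary part. The size condition provides at least one root, so the sum cannot
    vanish. *)
Lemma upper_nonvanishing_deriv (C : numClosedFieldType) (p : {poly C}) :
  upper_nonvanishing p -> (1 < size p)%N -> upper_nonvanishing p^`().
Proof.
move=> pnz szp z z_gt0.
have [r def_p] := closed_field_poly_normal p.
have p0 : p != 0 by rewrite -size_poly_gt0 (ltn_trans _ szp).
have c0 : lead_coef p != 0 by rewrite lead_coef_eq0.
have rneg a : a \in r -> 'Im a <= 0.
  move=> ar; have ra : root p a.
    by rewrite def_p rootZ // root_prod_XsubC.
  rewrite real_leNgt ?rpred0 ?Creal_Im //; apply/negP => a0.
  by move: (pnz _ a0); rewrite -rootE ra.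
have szr : r != [::].
  by apply: contraTneq szp => r0; rewrite def_p r0 big_nil alg_polyC size_polyC; case: (_ == _).
rewrite def_p derivZ hornerZ mulf_neq0 //.
set q := \prod_(a <- _) _.
have qnz : q.[z] != 0.
  by move: (pnz _ z_gt0); rewrite def_p hornerZ mulf_eq0 negb_or => /andP[].
suff: 'Im (q^`().[z] / q.[z]) < 0.
  by apply: contraTneq => ->; rewrite mul0r raddf0 ltxx.
have zr a : a \in r -> z - a != 0.
  move=> ar; rewrite subr_eq0; apply: contraTneq z_gt0 => ->.
  by apply/negP => a_gt0; have := lt_le_trans a_gt0 (rneg _ ar); rewrite ltxx.
rewrite log_deriv_prod // raddf_sum /=.
have neg a : a \in r -> 'Im (z - a)^-1 < 0.
  move=> ar; rewrite ImV mulNr oppr_lt0 divr_gt0 ?exprn_gt0 ?normr_gt0 ?zr //.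
  by rewrite raddfB /= subr_gt0 (le_lt_trans (rneg _ ar)).
move: szr neg; clear - z r; case: r => // a r _ neg.
rewrite big_cons -[ltRHS]addr0 ltr_leD ?neg ?inE ?eqxx // big_seq sumr_le0 // => b br.
by rewrite ltW // neg // inE br orbT.
Qed.

Lemma upper_nonvanishing_derivn (C : numClosedFieldType) (p : {poly C}) k :
  upper_nonvanishing p -> (k < size p)%N -> upper_nonvanishing p^`(k).
Proof.
move=> pnz; elim: k => [|k IH] ltkp; first by rewrite derivn0.
rewrite derivnS; apply: upper_nonvanishing_deriv; first exact: IH (ltnW ltkp).
rewrite ltnNge; apply/negP => sz1.
case szp: (size p) ltkp => // [m] lekm; have {}lekm : (k < m)%N := lekm.
(* If the [k]-th derivative were constant, its coefficient of index [m - k > 0] would vanish; but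
   that coefficient is a positive integer multiple of the leading coefficient of [p]. *)
have := size1_polyC sz1 => /(congr1 (fun q : {poly C} => q`_(m - k))).
rewrite coefC subn_eq0 leqNgt lekm /= coef_derivn subnKC ?(ltnW lekm) // => /eqP.
rewrite mulrn_eq0 -[p`_m]/(p`_(m.+1.-1)) -szp -lead_coefE lead_coef_eq0 -size_poly_eq0 szp orbF.
by rewrite eqn0Ngt ffact_gt0 ltnW.
Qed.

(** By elimination [det (X + s u v)] is the determinant of the bordered matrix with block rows
    [(1, - s v)] and [(u, X)]. There [s] occurs in the first row only, and multilinearity in that
    row makes the determinant affine in [s]. *)
Lemma det_rank_one_affine (K : comNzRingType) n (X : 'M[K]_n) (u : 'cV[K]_n) (v : 'rV[K]_n) (s : K) :
  \det (X + s *: (u *m v)) = \det X + s * (\det (X + u *m v) - \det X).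
Proof.
pose M (s : K) : 'M_(1 + n) := block_mx 1%:M (- (s *: v)) u X.
have detM r : \det (M r) = \det (X + r *: (u *m v)).
  have := det_mulmx (M r) (block_mx 1%:M (r *: v) 0 1%:M).
  rewrite det_ublock !det1 !mulr1 => <-; rewrite mulmx_block.
  rewrite !mulmx1 !mul1mx !mulmx0 !addr0 addrN det_lblock det1 mul1r.
  by rewrite -scalemxAr addrC.
have := @determinant_multilinear _ _ (M s) (M 0) (M 1) (lshift n 0) (1 - s) s.
rewrite !detM scale0r addr0 scale1r => ->.
- by ring.
- rewrite /M /block_mx !rowKu !row_id; apply/rowP => j; rewrite !mxE.
  by case: (split j) => a; rewrite !mxE; ring.
- by apply/matrixP => i j; rewrite /M /block_mx !mxE; case: splitP => a //=; rewrite (ord1 a).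
- by apply/matrixP => i j; rewrite /M /block_mx !mxE; case: splitP => a //=; rewrite (ord1 a).
Qed.

(** The shift is added rather than subtracted so that the coefficient of index [k] is [T_(n-k)]
    without a sign; see [coef_shift_detE]. *)
Definition shift_det (K : comNzRingType) n (A : 'M[K]_n) : {poly K} :=
  \det (map_mx polyC A + 'X%:M).

Lemma shift_detE (K : comNzRingType) n (A : 'M[K]_n) : shift_det A = char_poly (- A).
Proof. by rewrite /shift_det /char_poly /char_poly_mx map_mxN opprK addrC. Qed.

Lemma size_shift_det (K : comNzRingType) n (A : 'M[K]_n) : size (shift_det A) = n.+1.
Proof. by rewrite shift_detE size_char_poly. Qed.

Lemma horner_shift_det (K : comNzRingType) n (A : 'M[K]_n) z :
  (shift_det A).[z] = \det (A + z%:M).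
Proof.
rewrite -horner_evalE -det_map_mx; congr (\det _); apply/matrixP => i j.
by rewrite !mxE rmorphD rmorphMn /= /horner_eval hornerC hornerX.
Qed.

Lemma shift_det_rank_one (K : comNzRingType) n (A : 'M[K]_n) (v : 'rV[K]_n) (s : K) :
  shift_det (A + s *: (v^T *m v)) =
  shift_det A + s *: (shift_det (A + v^T *m v) - shift_det A).
Proof.
rewrite /shift_det -mul_polyC.
have e r : map_mx polyC (A + r *: (v^T *m v)) + 'X%:M =
  map_mx polyC A + 'X%:M + r%:P *: (map_mx polyC v^T *m map_mx polyC v).
  by rewrite map_mxD map_mxZ map_mxM addrAC.
by rewrite e det_rank_one_affine -[X in A + X]scale1r e scale1r.
Qed.

(** Multiplying a kernel row vector [w] by its conjugate transpose [w^H] gives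
    [w A w^H + s |w v^T|^2 + z |w|^2 = 0]. The first term is real, so the imaginary part of the left
    side is at least [Im z |w|^2 > 0]. *)
Lemma symmetric_pencil_det_neq0 (C : numClosedFieldType) n (A : 'M[C]_n) (v : 'rV[C]_n) (s z : C) :
  A^T = A -> map_mx Num.conj A = A -> map_mx Num.conj v = v ->
  0 < 'Im s -> 0 < 'Im z -> \det (A + s *: (v^T *m v) + z%:M) != 0.
Proof.
have entryD (X Y : 'M[C]_1) : (X + Y) 0 0 = X 0 0 + Y 0 0 by rewrite mxE.
have entryZ c (X : 'M[C]_1) : (c *: X) 0 0 = c * X 0 0 by rewrite mxE.
have entryM (X Y : 'M[C]_1) : (X *m Y) 0 0 = X 0 0 * Y 0 0 by rewrite mxE big_ord1.
have entryT (X : 'M[C]_1) : X^T 0 0 = X 0 0 by rewrite mxE.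
have entryJ (X : 'M[C]_1) : (map_mx Num.conj X) 0 0 = (X 0 0)^* by rewrite mxE.
move=> symA realA realv s_gt0 z_gt0; apply/negP => /det0P[w w0].
pose wc : 'cV_n := (map_mx Num.conj w)^T.
move=> /(congr1 (mulmx^~ wc)); rewrite mul0mx !mulmxDr !mulmxDl -scalemxAr -scalemxAl.
rewrite mul_mx_scalar -scalemxAl mulmxA -[_ *m v *m wc]mulmxA.
move=> /(congr1 (fun M : 'M_1 => M 0 0)).
rewrite !entryD !entryZ entryM [RHS]mxE.
set a := (_ *m _) 0 0; set b := (w *m v^T) 0 0; set b' := (v *m wc) 0 0; set N := (w *m wc) 0 0.
have conj_wc : map_mx Num.conj wc = w^T.
  by apply/matrixP => i j; rewrite !mxE conjCK.
have a_real : a \is Num.real.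
  apply/CrealP; rewrite /a -[RHS]entryT -entryJ.
  by rewrite !map_mxM !trmx_mul symA realA conj_wc mulmxA trmxK.
have b'E : b' = b^*.
  by rewrite /b' /b -entryJ -[LHS]entryT map_mxM -matrix.map_trmx realv trmx_mul trmxK.
have N_gt0 : 0 < N.
  rewrite /N mxE lt_neqAle eq_sym psumr_neq0 => [|j _]; last by rewrite !mxE mul_conjC_ge0.
  rewrite sumr_ge0 ?andbT => [|j _]; last by rewrite !mxE mul_conjC_ge0.
  have /rV0Pn[j wj0] := w0; apply/hasP; exists j; first by rewrite mem_index_enum.
  by rewrite !mxE lt_neqAle eq_sym mul_conjC_eq0 wj0 mul_conjC_ge0.
rewrite b'E => /(congr1 (fun x : C => 'Im x)).
rewrite !raddfD /= (Creal_ImP _ a_real) add0r raddf0.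
rewrite !ImMr ?ger0_real ?mul_conjC_ge0 ?(ltW N_gt0) // => /eqP.
rewrite gt_eqF // ltr_wpDl //; last by rewrite mulr_gt0.
by rewrite mulr_ge0 ?mul_conjC_ge0 // ltW.
Qed.

Local Notation toC := (real_complex _).

(* At [z = 'i y] the even and odd parts of [F] and [G] take real values; then [y] tends to [0]. *)
Lemma horner_upper_Im_ge0 (R : rcfType) (F G : {poly R}) :
  (forall z : R[i], 0 < 'Im z ->
     0 <= 'Im ((map_poly toC F).[z] * ((map_poly toC G).[z])^* )) ->
  0 <= F`_1 * G`_0 - F`_0 * G`_1.
Proof.
move=> ImFG; pose H := odd_poly F * even_poly G - even_poly F * odd_poly G.
have -> : F`_1 * G`_0 - F`_0 * G`_1 = H.[0].
  by rewrite hornerD hornerN !hornerM !horner_coef0 !coefE.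
have toC_real (x : R) : toC x \is Num.real by apply/complex_realP; exists x.
have evalE (P : {poly R}) y : (map_poly toC P).['i * toC y] =
    toC (even_poly P).[- y ^+ 2] + 'i * toC (y * (odd_poly P).[- y ^+ 2]).
  rewrite -[in LHS](poly_even_odd P) rmorphD /= rmorphM /= map_polyX hornerD hornerM hornerX.
  rewrite !map_comp_poly map_polyXn !horner_comp !hornerXn exprMn sqrCi mulN1r -rmorphXn -rmorphN.
  rewrite !horner_map rmorphM /=; ring.
have H_ge0 y : 0 < y -> 0 <= H.[- y ^+ 2].
  move=> y_gt0; have y_gt0' : 0 < toC y by rewrite ltcR.
  have := ImFG ('i * toC y); rewrite ImMil (Creal_ReP _ (toC_real _)) => /(_ y_gt0').
  rewrite !evalE ImM Re_conj Im_conj !Im_rect ?Re_rect //.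
  set a := (even_poly F).[_]; set b := (odd_poly F).[_].
  set c := (even_poly G).[_]; set d := (odd_poly G).[_].
  rewrite -rmorphN -!rmorphM -rmorphD ler0c.
  have -> : a * - (y * d) + c * (y * b) = y * (b * c - a * d) by ring.
  by rewrite pmulr_rge0 // hornerD hornerN !hornerM.
rewrite leNgt; apply/negP => H0_lt0.
have oppH_gt0 : 0 < - H.[0] by rewrite oppr_gt0.
have [e e_gt0 He] := poly_cont 0 H oppH_gt0.
pose y := Num.min 1 (e / 2).
have y_gt0 : 0 < y by rewrite lt_min ltr01 divr_gt0.
have y_le1 : y <= 1 by rewrite ge_min lexx.
have y_lte : y < e by rewrite gt_min orbC ltr_pdivrMr // ltr_pMr // ltr1n.
have := He (- y ^+ 2); rewrite subr0 normrN ger0_norm ?sqr_ge0 //.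
have -> : y ^+ 2 < e by rewrite (le_lt_trans _ y_lte) // expr2 ler_piMr // ltW.
move=> /(_ isT) /(le_lt_trans (ler_norm _)).
by rewrite ltrBlDr addNr ltNge H_ge0.
Qed.

(** With [G = F' - F] the determinant of the pencil is [F + s G], so its [k]-th derivative in [z]
    has no zero when [s] and [z] lie in the upper half-plane. The resulting Wronskian of [F] and [G]
    equals that of [F] and [F'], since the contribution of [F] with itself cancels. *)
Lemma shift_det_wronskian (R : rcfType) n (A : 'M[R]_n) (v : 'rV[R]_n) k :
  A^T = A -> (k < n)%N ->
  0 <= (shift_det A)`_k.+1 * (shift_det (A + v^T *m v))`_k
       - (shift_det A)`_k * (shift_det (A + v^T *m v))`_k.+1.
Proof.
move=> symA ltkn; set F := shift_det A; set F' := shift_det (A + _); pose G := F' - F.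
have stable (s z : R[i]) : 0 < 'Im s -> 0 < 'Im z ->
    (map_poly toC F^`(k)).[z] + s * (map_poly toC G^`(k)).[z] != 0.
  move=> s_gt0 z_gt0; pose AC := map_mx toC A; pose vC := map_mx toC v.
  have mapS (B : 'M[R]_n) : map_poly toC (shift_det B) = shift_det (map_mx toC B).
    by rewrite !shift_detE map_char_poly map_mxN.
  have -> : (map_poly toC F^`(k)).[z] + s * (map_poly toC G^`(k)).[z] =
     (shift_det (AC + s *: (vC^T *m vC)))^`(k).[z].
    rewrite shift_det_rank_one -hornerZ -hornerD -!derivn_map -derivnZ -derivnD.
    by rewrite /G rmorphB /= !mapS map_mxD map_mxM matrix.map_trmx.
  apply: upper_nonvanishing_derivn z_gt0 => [w w_gt0|]; last first.
    by rewrite size_shift_det ltnW.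
  rewrite horner_shift_det symmetric_pencil_det_neq0 //.
  - by rewrite /AC matrix.map_trmx symA.
  - by apply/matrixP => i j; rewrite !mxE; apply/CrealP/complex_realP; exists (A i j).
  - by apply/matrixP => i j; rewrite !mxE; apply/CrealP/complex_realP; exists (v i j).
have : 0 <= F^`(k)`_1 * G^`(k)`_0 - F^`(k)`_0 * G^`(k)`_1.
  apply: horner_upper_Im_ge0 => z z_gt0.
  rewrite real_leNgt ?rpred0 ?Creal_Im //; apply/negP => FG_lt0.
  set f := (map_poly _ F^`(k)).[z] in FG_lt0; set g := (map_poly _ G^`(k)).[z] in FG_lt0.
  have g0 : g != 0 by apply: contraTneq FG_lt0 => ->; rewrite rmorph0 mulr0 raddf0 ltxx.
  (* This is the value of [s] at which [f + s g] vanishes; a negative imaginary part of [f] times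
     the conjugate of [g] would put it in the upper half-plane. *)
  have := stable (- f / g) z _ z_gt0; rewrite divfK // addrN eqxx; case/(_ _)/negP => //.
  rewrite mulNr raddfN oppr_gt0 /= invC_norm mulrCA.
  by rewrite ImMl ?pmulr_rlt0 ?invr_gt0 ?exprn_gt0 ?normr_gt0 // ger0_real // invr_ge0 exprn_ge0.
(* The coefficients of index 0 and 1 of a [k]-th derivative are [k!] and [(k+1)!] times those of
   index [k] and [k+1]; this common positive factor is divided out. *)
rewrite !coef_derivn addn1 addn0 !mulrnAl !mulrnAr -!mulrnA [(_ * k ^_ k)%N]mulnC -mulrnBl.
rewrite pmulrn_lge0 ?muln_gt0 ?ffact_gt0 ?leqnn ?leqnSn // !coefB.
by rewrite !mulrBr [F`_k * F`_k.+1]mulrC opprB addrA subrK.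
Qed.

Lemma coef_shift_det_top (K : comNzRingType) n (A : 'M[K]_n) : (shift_det A)`_n = 1.
Proof.
have := char_poly_monic (- A); rewrite -shift_detE monicE /lead_coef size_shift_det => /eqP.
exact.
Qed.

Lemma shift_det_addC (K : comNzRingType) n (A : 'M[K]_n) (a : K) :
  shift_det (A + a%:M) = shift_det A \Po ('X + a%:P).
Proof.
rewrite /shift_det -det_map_mx; congr (\det _); apply/matrixP => i j; rewrite !mxE /=.
rewrite comp_polyD comp_polyC polyCD polyCMn; case: (i == j);
  rewrite /= ?mulr0n ?mulr1n ?comp_polyX ?comp_poly0 ?addr0 //; ring.
Qed.

Lemma coef_comp_poly_XaddC (K : comNzRingType) (p : {poly K}) a k :
  (p \Po ('X + a%:P))`_k = p^`N(k).[a].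
Proof.
rewrite /comp_poly addrC (nderiv_taylor _ (commr_polyX _)) size_map_polyC.
transitivity (\poly_(i < size p) p^`N(i).[a])`_k.
  rewrite poly_def !coef_sum; apply: eq_bigr => i _.
  by rewrite nderivn_map horner_map mul_polyC.
by rewrite coef_poly; case: ltnP => // lek; rewrite nderivn_poly0 ?horner0.
Qed.

(** By Taylor's formula the new coefficient is the sum of [binom (k+j) k c_(k+j) a^j]. The term
    [j = 0] is the old coefficient, the term [j = n - k] is at least [a^(n-k)] because the
    polynomial is monic, and the terms between are nonnegative. The sign of the old coefficient [k]
    is left free, which [upper_barrier_Em] exploits in degree [m]. *)
Lemma coef_shift_det_ge (R : realFieldType) n (A : 'M[R]_n) (a : R) k :
  0 <= a -> (k < n)%N -> (forall j, (k < j)%N -> 0 <= (shift_det A)`_j) ->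
  (shift_det A)`_k + a ^+ (n - k) <= (shift_det (A + a%:M))`_k.
Proof.
move=> a_ge0 ltkn pos; rewrite shift_det_addC coef_comp_poly_XaddC.
have sz : (size (shift_det A)^`N(k) <= (n - k).+1)%N.
  apply/leq_sizeP => j ltj; rewrite coef_nderivn nth_default ?mul0rn //.
  by rewrite size_shift_det; lia.
rewrite (horner_coef_wide _ sz) -(subnSK ltkn) big_ord_recr big_ord_recl /=.
rewrite !coef_nderivn addn0 binn mulr1n expr0 mulr1 subnSK // subnKC ?(ltnW ltkn) //.
rewrite coef_shift_det_top -addrA lerD2l -[X in X <= _]add0r lerD //.
  apply: sumr_ge0 => i _; rewrite coef_nderivn mulr_ge0 ?exprn_ge0 // mulrn_wge0 // pos //.
  by rewrite /= /bump /=; lia.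
by rewrite -[X in X <= _]mul1r ler_wpM2r ?exprn_ge0 // ler1n bin_gt0 ltnW.
Qed.

(** * Coefficients of the shifted determinant as sums of principal minors *)

Definition mxf (K : Type) (k : nat) (M : nat -> nat -> K) : 'M[K]_k := \matrix_(i < k, j < k) M i j.

Lemma eq_mxf (K : Type) k (M N : nat -> nat -> K) :
  (forall i j, (i < k)%N -> (j < k)%N -> M i j = N i j) -> mxf k M = mxf k N.
Proof. by move=> MN; apply/matrixP => i j; rewrite !mxE MN. Qed.

Lemma sumRE k g : sumR k g = \sum_(i < k) g (i : nat).
Proof. by elim: k => [|k IH] /=; rewrite ?big_ord0 // big_ord_recr /= IH. Qed.

Lemma detE k M : det k M = \det (mxf k M).
Proof.
elim: k M => [|k IH] M; first by rewrite det_mx00.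
rewrite (expand_det_row _ ord0) det_succ sumRE; apply: eq_bigr => j _.
rewrite /= IH /cofactor mxE add0n !RmultE RpowE [_ * M _ _]mulrC -mulrA.
congr (M _ _ * (_ * \det _)); apply/matrixP => a b; rewrite !mxE /minor /=; congr (M _ _).
rewrite /bump; case: Nat.ltb_spec => ltbj; case: leqP => lejb //; lia.
Qed.

(** Row [r] splits by multilinearity; the added row is [x] times a unit vector, whose only cofactor
    lies on the diagonal and has sign 1. Deleting row and column [r] is reindexing by [bump r]. *)
Lemma det_diag_entry (K : comNzRingType) k (M : nat -> nat -> K) r x : (r <= k)%N ->
  \det (mxf k.+1 (fun i j => M i j + x *+ ((i == r) && (j == r)))) =
  \det (mxf k.+1 M) + x * \det (mxf k (fun i j => M (bump r i) (bump r j))).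
Proof.
move=> lerk; pose r' : 'I_k.+1 := Ordinal (lerk : (r < k.+1)%N).
pose N i j := if i == r then (j == r)%:R else M i j.
rewrite (@determinant_multilinear _ _ _ (mxf k.+1 M) (mxf k.+1 N) r' 1 x).
- rewrite mul1r; congr (_ + x * _).
  rewrite (expand_det_row _ r') (bigD1 r') //= big1 ?addr0 => [|j jr].
    rewrite mxE /N !eqxx mul1r /cofactor -signr_odd addnn odd_double expr0 mul1r.
    congr (\det _); apply/matrixP => i j; rewrite !mxE /= /bump.
    by case: eqP => //; lia.
  by rewrite mxE /N eqxx -[(j : nat) == r]/(j == r') (negbTE jr) mul0r.
- by apply/rowP => j; rewrite !mxE /N eqxx /= mul1r mulr_natr.
- apply/matrixP => i j; rewrite !mxE /=.
  by rewrite (_ : bump r i == r = false) ?addr0 // /bump; apply/eqP; lia.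
- apply/matrixP => i j; rewrite !mxE /= /N.
  by rewrite (_ : bump r i == r = false) ?addr0 // /bump; apply/eqP; lia.
Qed.

Lemma nth_bump pre a l i :
  List.nth (bump (length pre) i) (pre ++ a :: l)%list O = List.nth i (pre ++ l)%list O.
Proof.
elim: pre i => [|b pre IH] [|i] //=.
by rewrite -IH bumpS.
Qed.

Section PartialShiftDet.
Variable M : Mat.

(** Generalizes [Tp] to index sets made of all of [pre] and [p] members of [l], so that the
    recursion of [subsets] can be followed one head at a time. *)
Definition minor_sum (pre l : list nat) (p : nat) : R :=
  List.fold_right Rplus 0 (List.map (fun I => principal_minor (pre ++ I)%list M) (subsets l p)).

(** The generating polynomial of the sums [minor_sum pre l p]: the variable sits only on the
    diagonal places of [l], the indices still undecided. *)
Definition partial_shift_det (pre l : list nat) : {poly R} :=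
  \det (mxf (length (pre ++ l)%list) (fun i j =>
    (M (List.nth i (pre ++ l)%list O) (List.nth j (pre ++ l)%list O))%:P
      + 'X *+ ((i == j) && (length pre <= i)%N))).

Lemma minor_sum_cons pre a l p :
  minor_sum pre (a :: l) p.+1 = minor_sum (pre ++ [:: a])%list l p + minor_sum pre l p.+1.
Proof.
rewrite /minor_sum /= List.map_app List.fold_right_app List.map_map.
set t := List.fold_right _ _ (List.map _ (subsets l p.+1)).
rewrite (List.map_ext _ (fun I => principal_minor ((pre ++ [:: a]) ++ I)%list M)); last first.
  by move=> I; rewrite -List.app_assoc.
elim: (List.map _ _) => [|x s IH] /=; first by rewrite add0r.
by rewrite IH RplusE addrA.
Qed.

Lemma minor_sum_gt pre l p : (length l < p)%N -> minor_sum pre l p = 0.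
Proof.
elim: l p pre => [|a l IH] [|p] pre //= ltlp.
by rewrite minor_sum_cons !IH ?addr0 // ltnW.
Qed.

(** Expansion in the diagonal place of [a]: without the variable [a] joins the chosen indices, with
    the variable its row and column are deleted. This is the same dichotomy as in [subsets]. *)
Lemma partial_shift_det_cons pre a l :
  partial_shift_det pre (a :: l) =
  partial_shift_det (pre ++ [:: a])%list l + 'X * partial_shift_det pre l.
Proof.
rewrite /partial_shift_det.
have -> : length (pre ++ a :: l)%list = (length (pre ++ l)%list).+1.
  by rewrite !List.length_app /=; lia.
have ler : (length pre <= length (pre ++ l)%list)%N by rewrite List.length_app; lia.
have -> : length ((pre ++ [:: a]) ++ l)%list = (length (pre ++ l)%list).+1.
  by rewrite !List.length_app /=; lia.
set k := length (pre ++ l)%list in ler *; set r := length pre in ler *.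
pose N i j := (M (List.nth i (pre ++ a :: l)%list O) (List.nth j (pre ++ a :: l)%list O))%:P
      + 'X *+ ((i == j) && (r < i)%N) : {poly R}.
rewrite (_ : mxf k.+1 _ = mxf k.+1 (fun i j => N i j + 'X *+ ((i == r) && (j == r)))); last first.
  apply: eq_mxf => i j _ _; rewrite /N -addrA -mulrnDr; congr (_ + _ *+ _).
  by rewrite [(r <= i)%N]leq_eqVlt; case: (i =P j) => [<-|]; case: (i =P r); case: (j =P r); case: (r =P i); lia.
rewrite (det_diag_entry _ _ ler).
apply: f_equal2; last apply: f_equal2 => //; congr (\det _); apply: eq_mxf => i j _ _; rewrite /N.
  rewrite -!List.app_assoc /= (_ : length (pre ++ [:: a])%list = r.+1) //.
  by rewrite List.length_app /= /r; lia.
rewrite !nth_bump; congr (_ + _ *+ (_ : bool)); rewrite /bump; lia.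
Qed.

Lemma coef_partial_shift_det pre l q :
  (partial_shift_det pre l)`_q = if (q <= length l)%N then minor_sum pre l (length l - q) else 0.
Proof.
elim: l pre q => [|a l IH] pre q.
  have -> : partial_shift_det pre nil = (principal_minor pre M)%:P.
    rewrite /partial_shift_det List.app_nil_r /principal_minor detE -det_map_mx.
    apply: (f_equal determinant); apply/matrixP => i j.
    by rewrite !mxE [(length pre <= i)%N]leqNgt ltn_ord andbF addr0.
  rewrite coefC leqn0; case: eqP => // ->.
  by rewrite /minor_sum /= List.app_nil_r RplusE addr0.
rewrite partial_shift_det_cons coefD coefXM !IH /=.
case: q => [|q] /=.
  by rewrite !subn0 minor_sum_cons addr0 (minor_sum_gt _ (ltnSn _)) addr0.
rewrite ltnS subSS; case: ltngtP => [ltq|ltq|->]; rewrite ?addr0 //.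
  rewrite -(subnSK ltq) minor_sum_cons //.
by rewrite subnn add0r /minor_sum; case: (l).
Qed.
End PartialShiftDet.

Lemma coef_shift_detE n M q : (q <= n)%N ->
  (shift_det (mxf n M))`_q = Tp n (n - q) M.
Proof.
move=> leqn; transitivity (partial_shift_det M nil (List.seq 0 n))`_q; last first.
  by rewrite coef_partial_shift_det List.length_seq leqn.
congr (_`_q); rewrite /partial_shift_det /shift_det /= List.length_seq.
do 2 apply: f_equal; apply/matrixP => i j; rewrite !mxE andbT.
by rewrite !List.seq_nth //; apply/ssrnat.ltP.
Qed.

(** This is [shift_det_wronskian] for [k = n - p], phrased with the orders and operations of the
    standard library for use outside this module. *)
Lemma Tp_rank_one n p (M : Mat) (v : nat -> R) :
  (forall i j, Peano.lt i n -> Peano.lt j n -> M i j = M j i) -> Peano.le 1 p -> Peano.le p n ->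
  Rle (Rmult (Tp n p M) (Tp n (Nat.pred p) (fun i j => Rplus (M i j) (Rmult (v i) (v j)))))
      (Rmult (Tp n (Nat.pred p) M) (Tp n p (fun i j => Rplus (M i j) (Rmult (v i) (v j))))).
Proof.
move=> symM /ssrnat.leP p_gt0 /ssrnat.leP lepn; set N := fun i j => Rplus _ _.
have NE : mxf n N = mxf n M + (\row_(i < n) v i)^T *m (\row_(i < n) v i).
  by apply/matrixP => i j; rewrite !mxE big_ord1 !mxE.
have symM' : (mxf n M)^T = mxf n M.
  by apply/matrixP => i j; rewrite !mxE symM //; apply/ssrnat.ltP.
have ltk : (n - p < n)%N by lia.
have := shift_det_wronskian (\row_(i < n) v i) symM' ltk.
rewrite -NE !coef_shift_detE //; try lia.
have -> : (n - (n - p))%N = p by lia.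
have -> : (n - (n - p).+1)%N = Nat.pred p by lia.
by rewrite subr_ge0 => h; apply/RleP; rewrite !RmultE.
Qed.

Lemma Tp_shift_ge n p (M : Mat) (a : R) :
  Rle R0 a -> Peano.le 1 p -> Peano.le p n ->
  (forall j, Peano.lt j p -> Rle R0 (Tp n j M)) ->
  Rle (Rplus (Tp n p M) (pow a p)) (Tp n p (fun i j => Rplus (M i j) (if Nat.eqb i j then a else R0))).
Proof.
move=> /RleP a_ge0 /ssrnat.leP p_gt0 /ssrnat.leP lepn pos; set N := fun i j => Rplus _ _.
have NE : mxf n N = mxf n M + a%:M.
  apply/matrixP => i j; rewrite !mxE /N RplusE; congr (_ + _).
  case: Nat.eqb_spec => [/val_inj ->|]; first by rewrite eqxx.
  by rewrite -[i == j]/((i : nat) == j); case: eqP.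
have ltk : (n - p < n)%N by lia.
have pos' j : (n - p < j)%N -> 0 <= (shift_det (mxf n M))`_j.
  move=> ltj; case: (leqP j n) => [lejn|ltnj]; last first.
    by rewrite nth_default // size_shift_det.
  by rewrite coef_shift_detE //; apply/RleP/pos/ssrnat.ltP; lia.
have := coef_shift_det_ge a_ge0 ltk pos'.
rewrite -NE !coef_shift_detE ?leq_subr // subKn // => h.
by apply/RleP; rewrite RplusE RpowE.
Qed.

End MinorSums.

(** * The cones of k-positive matrices *)

Definition symmetric (n : nat) (M : Mat) : Prop :=
  forall i j, (i < n)%nat -> (j < n)%nat -> M i j = M j i.

Lemma sumR_ext k g h : (forall i, (i < k)%nat -> g i = h i) -> sumR k g = sumR k h.
Proof.
  intros E; induction k as [|k IH]; simpl; auto.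
  rewrite IH, E; auto with arith.
Qed.

Lemma sumR_plus k g h : sumR k (fun i => g i + h i) = sumR k g + sumR k h.
Proof. induction k as [|k IH]; simpl; [|rewrite IH]; lra. Qed.

Lemma sumR_scal k c g : sumR k (fun i => c * g i) = c * sumR k g.
Proof. induction k as [|k IH]; simpl; [|rewrite IH]; lra. Qed.

Lemma sumR_0 k g : (forall i, (i < k)%nat -> g i = 0) -> sumR k g = 0.
Proof.
  intros E; induction k as [|k IH]; simpl; auto.
  rewrite IH, E; auto with arith; lra.
Qed.

Lemma sumR_single k r g : (r < k)%nat -> (forall i, (i < k)%nat -> i <> r -> g i = 0) ->
  sumR k g = g r.
Proof.
  intros Hr E; induction k as [|k IH]; [lia|]; simpl.
  destruct (Nat.eq_dec r k) as [->|Hrk].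
  - rewrite sumR_0; [lra|]. intros i Hi; apply E; lia.
  - rewrite IH, (E k); [lra|lia|lia|lia|]. intros; apply E; lia.
Qed.

Lemma sumR_succ_l k g : sumR (S k) g = g O + sumR k (fun i => g (S i)).
Proof.
  induction k as [|k IH]; [simpl; lra|].
  change (sumR (S (S k)) g) with (sumR (S k) g + g (S k)); rewrite IH; simpl; lra.
Qed.

Lemma det_ext k M N :
  (forall i j, (i < k)%nat -> (j < k)%nat -> M i j = N i j) -> det k M = det k N.
Proof.
  revert M N; induction k as [|k IH]; intros M N E; auto.
  rewrite !det_succ; apply sumR_ext; intros j Hj.
  rewrite E by lia; f_equal; apply IH; intros a b Ha Hb; unfold minor.
  apply E; [lia|]; destruct (Nat.ltb_spec b j); lia.
Qed.

Lemma subsets_incl l p I : In I (subsets l p) -> incl I l.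
Proof.
  revert p I; induction l as [|a l IH]; intros [|p] I; simpl.
  - intros [<-|[]]; apply incl_refl.
  - intros [].
  - intros [<-|[]]; apply incl_nil_l.
  - rewrite in_app_iff, in_map_iff; intros [[J [<- HJ]]|HI].
    + intros x [->|Hx]; [left; auto|right; apply (IH _ _ HJ); auto].
    + intros x Hx; right; apply (IH _ _ HI); auto.
Qed.

Lemma Tp_ext n p M N :
  (forall i j, (i < n)%nat -> (j < n)%nat -> M i j = N i j) -> Tp n p M = Tp n p N.
Proof.
  intros E; unfold Tp; f_equal; apply map_ext_in; intros I HI; apply subsets_incl in HI.
  apply det_ext; intros a b Ha Hb.
  apply E; apply (in_seq n 0), HI, nth_In; auto.
Qed.

Lemma Tp_0 n M : Tp n 0 M = 1.
Proof. unfold Tp; destruct (seq 0 n); simpl; unfold principal_minor; simpl; lra. Qed.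

(** The matrix [diag (s, M)]. The extra coordinate has index 0 because [det] expands along the first
    row and [subsets] decides the head of its list first. *)
Definition block (s : R) (M : Mat) : Mat :=
  fun i j => match i, j with O, O => s | S a, S b => M a b | _, _ => 0 end.

Lemma symmetric_block n s M : symmetric n M -> symmetric (S n) (block s M).
Proof. intros H [|i] [|j] Hi Hj; simpl; auto; apply H; lia. Qed.

Lemma subsets_map (f : nat -> nat) l p : subsets (map f l) p = map (map f) (subsets l p).
Proof.
  revert p; induction l as [|a l IH]; intros [|p]; simpl; auto.
  rewrite !IH, map_app, !map_map; auto.
Qed.

Lemma fold_right_Rplus_app l l' :
  fold_right Rplus 0 (l ++ l') = fold_right Rplus 0 l + fold_right Rplus 0 l'.
Proof. induction l as [|a l IH]; simpl; [|rewrite IH]; lra. Qed.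

Lemma fold_right_Rplus_scal {A} s (g : A -> R) l :
  fold_right Rplus 0 (map (fun x => s * g x) l) = s * fold_right Rplus 0 (map g l).
Proof. induction l as [|a l IH]; simpl; [|rewrite IH]; lra. Qed.

Lemma principal_minor_block s M I :
  principal_minor (O :: map S I) (block s M) = s * principal_minor I M.
Proof.
  unfold principal_minor; simpl length; rewrite length_map, det_succ.
  rewrite (sumR_single _ O); [|lia|].
  - simpl; rewrite !Rmult_1_l; f_equal; apply det_ext; intros a b Ha Hb.
    unfold minor; simpl; rewrite !(nth_indep _ O 1%nat) by (rewrite length_map; auto).
    change 1%nat with (S O); rewrite !map_nth; reflexivity.
  - intros [|i] Hi Hi0; [lia|]; simpl.
    rewrite (nth_indep _ O 1%nat) by (rewrite length_map; lia).
    change 1%nat with (S O); rewrite map_nth; simpl; ring.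
Qed.

(** A principal minor that uses the extra index has the factor [s]; one that avoids it is a
    principal minor of [M]. *)
Lemma Tp_block n p s M :
  Tp (S n) (S p) (block s M) = s * Tp n p M + Tp n (S p) M.
Proof.
  unfold Tp; simpl seq; rewrite <- seq_shift; simpl subsets.
  rewrite map_app, fold_right_Rplus_app, !subsets_map, !map_map; f_equal.
  - rewrite <- fold_right_Rplus_scal; f_equal; apply map_ext; intros I.
    apply principal_minor_block.
  - f_equal; apply map_ext; intros I; unfold principal_minor; rewrite length_map.
    apply det_ext; intros a b Ha Hb.
    rewrite !(nth_indep (map S I) O 1%nat) by (rewrite length_map; auto).
    change 1%nat with (S O); rewrite !map_nth; reflexivity.
Qed.

Lemma Em_block n m ut H : (1 <= m)%nat -> Em n m ut H = Tp (S n) m (block (- ut) H).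
Proof.
  intros Hm; destruct m as [|m]; [lia|].
  unfold Em; rewrite Tp_block; simpl; rewrite Nat.sub_0_r; reflexivity.
Qed.

(* The rank-one inequality for [block 0 M] in the direction of the extra coordinate. *)
Lemma Tp_newton n p M : symmetric n M -> (1 <= p)%nat -> (p <= n)%nat ->
  Tp n (S p) M * Tp n (p - 1) M <= Tp n p M * Tp n p M.
Proof.
  intros HM Hp Hpn; destruct p as [|p]; [lia|]; simpl Nat.sub; rewrite Nat.sub_0_r.
  pose (v := fun i => match i with O => 1 | S _ => 0 end).
  assert (W := @MinorSums.Tp_rank_one (S n) (S (S p)) (block 0 M) v
                 (symmetric_block n 0 M HM) ltac:(lia) ltac:(lia)).
  assert (E : forall q, Tp (S n) q (fun i j => block 0 M i j + v i * v j) = Tp (S n) q (block 1 M)).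
  { intros q; apply Tp_ext; intros [|i] [|j] _ _; simpl; ring. }
  (* For [k = p + 1] the inequality becomes [T_(k+1) (T_(k-1) + T_k) <= T_k (T_k + T_(k+1))], and
     the products [T_k T_(k+1)] cancel. *)
  rewrite !E in W; simpl Nat.pred in W; rewrite !Tp_block in W; lra.
Qed.

Lemma k_positive_0 n k M p : k_positive n k M -> (p <= k)%nat -> 0 < Tp n p M.
Proof.
  intros H Hp; destruct p as [|p]; [rewrite Tp_0; lra|apply H; lia].
Qed.

(** The rank-one inequality says that the quotient [T_p / T_(p-1)] does not decrease; since by
    induction [T_(p-1)] does not decrease either, neither does [T_p]. *)
Lemma k_positive_add_rank_one n k M v : symmetric n M -> (k <= n)%nat -> k_positive n k M ->
  k_positive n k (fun i j => M i j + v i * v j) /\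
  forall p, (p <= k)%nat -> Tp n p M <= Tp n p (fun i j => M i j + v i * v j).
Proof.
  intros HM Hk HK.
  assert (H : forall p, (p <= k)%nat -> Tp n p M <= Tp n p (fun i j => M i j + v i * v j)).
  { induction p as [|p IH]; intros Hp; [rewrite !Tp_0; lra|].
    assert (W := @MinorSums.Tp_rank_one n (S p) M v HM ltac:(lia) ltac:(lia)); simpl in W.
    assert (H1 := k_positive_0 n k M p HK ltac:(lia)).
    assert (H2 := k_positive_0 n k M (S p) HK ltac:(lia)).
    specialize (IH ltac:(lia)); nra. }
  split; auto; intros p Hp1 Hp; apply Rlt_le_trans with (Tp n p M); auto.
Qed.

Definition qform (n : nat) (C : Mat) (x : nat -> R) : R :=
  sumR n (fun i => sumR n (fun j => C i j * x i * x j)).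

Lemma qform_add_coord n C x r t : symmetric n C -> (r < n)%nat ->
  qform n C (fun i => x i + t * (if Nat.eqb i r then 1 else 0)) =
  qform n C x + 2 * t * sumR n (fun j => C r j * x j) + t * t * C r r.
Proof.
  intros HC Hr; unfold qform; pose (e := fun i => if Nat.eqb i r then 1 else 0).
  assert (e_r : e r = 1) by (unfold e; rewrite Nat.eqb_refl; auto).
  assert (e_ne : forall i, i <> r -> e i = 0).
  { intros i Hi; unfold e; apply Nat.eqb_neq in Hi; rewrite Hi; auto. }
  transitivity (sumR n (fun i => sumR n (fun j => C i j * x i * x j) +
     (t * (e i * sumR n (fun j => C i j * x j)) +
      (t * (x i * C i r) + t * t * (e i * C i r))))).
  - apply sumR_ext; intros i Hi.
    transitivity (sumR n (fun j => C i j * x i * x j + ((t * e i) * (C i j * x j) +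
        (t * x i + t * t * e i) * (C i j * e j)))).
    + apply sumR_ext; intros j Hj; unfold e; ring.
    + rewrite !sumR_plus, !sumR_scal, (sumR_single n r (fun j => C i j * e j)); auto.
      * rewrite e_r; ring.
      * intros j _ Hj; rewrite e_ne; auto; ring.
  - rewrite !sumR_plus, !sumR_scal.
    rewrite (sumR_single n r (fun i => e i * sumR n (fun j => C i j * x j))); auto.
    2: intros i _ Hi; rewrite e_ne; auto; ring.
    rewrite (sumR_single n r (fun i => e i * C i r)); auto.
    2: intros i _ Hi; rewrite e_ne; auto; ring.
    rewrite (sumR_ext n (fun i => x i * C i r) (fun j => C r j * x j)).
    + rewrite e_r; ring.
    + intros i Hi; rewrite HC; auto; ring.
Qed.

Definition psd (n : nat) (C : Mat) : Prop := forall x, 0 <= qform n C x.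

Lemma psd_diag_ge0 n C r : symmetric n C -> psd n C -> (r < n)%nat -> 0 <= C r r.
Proof.
  intros HC HP Hr; assert (H := HP (fun i => 0 + 1 * (if Nat.eqb i r then 1 else 0))).
  rewrite (qform_add_coord n C (fun _ => 0)) in H; auto.
  rewrite (sumR_0 n (fun j => C r j * 0)) in H by (intros; ring).
  unfold qform in H; rewrite sumR_0 in H; [lra|].
  intros i Hi; apply sumR_0; intros; ring.
Qed.

Lemma psd_diag_eq0 n C r j : symmetric n C -> psd n C -> (r < n)%nat -> (j < n)%nat ->
  C r r = 0 -> C r j = 0.
Proof.
  intros HC HP Hr Hj H0.
  pose (y := fun i => if Nat.eqb i j then 1 else 0).
  assert (HL : sumR n (fun i => C r i * y i) = C r j).
  { rewrite (sumR_single n j); auto; unfold y.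
    - rewrite Nat.eqb_refl; ring.
    - intros i _ Hi; apply Nat.eqb_neq in Hi; rewrite Hi; ring. }
  destruct (Req_dec (C r j) 0) as [|Hne]; auto; exfalso.
  (* With a zero diagonal entry the form is affine along the [r]-th coordinate with slope
     [2 * C r j]; this multiple brings its value to [-1]. *)
  assert (H := HP (fun i => y i + (- (qform n C y + 1) / (2 * C r j)) * (if Nat.eqb i r then 1 else 0))).
  rewrite qform_add_coord, HL, H0 in H; auto.
  replace (2 * (- (qform n C y + 1) / (2 * C r j)) * C r j) with (- (qform n C y + 1)) in H by (field; auto).
  lra.
Qed.

Lemma qform_sub_rank_one n C v x :
  qform n (fun i j => C i j - v i * v j) x = qform n C x - (sumR n (fun i => v i * x i)) ^ 2.
Proof.
  unfold qform; transitivity (sumR n (fun i => sumR n (fun j => C i j * x i * x j)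
     + (- sumR n (fun j => v j * x j)) * (v i * x i))).
  - apply sumR_ext; intros i Hi.
    transitivity (sumR n (fun j => C i j * x i * x j + (- (v i * x i)) * (v j * x j))).
    + apply sumR_ext; intros; ring.
    + rewrite sumR_plus, sumR_scal; ring.
  - rewrite sumR_plus, sumR_scal; ring.
Qed.

(* Cholesky elimination writes [C] as a sum of matrices [v v^T]. *)
Lemma k_positive_add_psd n k M C : symmetric n M -> symmetric n C -> psd n C ->
  (k <= n)%nat -> k_positive n k M ->
  k_positive n k (fun i j => M i j + C i j) /\
  forall p, (p <= k)%nat -> Tp n p M <= Tp n p (fun i j => M i j + C i j).
Proof.
  intros HM HC HP Hk HK.
  (* [d] counts the rows not yet eliminated: the first [n - d] rows of [C] vanish. *)
  assert (main : forall d, (d <= n)%nat -> forall M C, symmetric n M -> symmetric n C -> psd n C ->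
    k_positive n k M -> (forall i j, (i < n - d)%nat -> (j < n)%nat -> C i j = 0) ->
    k_positive n k (fun i j => M i j + C i j) /\
    forall p, (p <= k)%nat -> Tp n p M <= Tp n p (fun i j => M i j + C i j)).
  { clear M C HM HC HP HK; induction d as [|d IH]; intros Hd M C HM HC HP HK H0.
    - assert (E : forall p, Tp n p (fun i j => M i j + C i j) = Tp n p M).
      { intros p; apply Tp_ext; intros i j Hi Hj; rewrite H0; [ring|lia|lia]. }
      split; [intros p Hp1 Hp; rewrite E; auto|intros p Hp; rewrite E; lra].
    - set (r := (n - S d)%nat); assert (Hr : (r < n)%nat) by (unfold r; lia).
      destruct (Req_dec (C r r) 0) as [Hrr|Hrr].
      + apply IH; auto; [lia|]; intros i j Hi Hj.
        destruct (Nat.eq_dec i r) as [->|Hir]; [apply (psd_diag_eq0 n); auto|].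
        apply H0; unfold r in *; lia.
      + assert (Hpos : 0 < C r r) by (assert (H := psd_diag_ge0 n C r HC HP Hr); lra).
        (* Row [r] is scaled so that [v v^T] has the same row and column [r] as [C]. *)
        pose (v := fun i => C r i / sqrt (C r r)).
        assert (Hs : sqrt (C r r) * sqrt (C r r) = C r r) by (apply sqrt_sqrt; lra).
        assert (Hs0 : 0 < sqrt (C r r)) by (apply sqrt_lt_R0; auto).
        destruct (k_positive_add_rank_one n k M v HM Hk HK) as [K1 T1].
        destruct (IH ltac:(lia) (fun i j => M i j + v i * v j) (fun i j => C i j - v i * v j))
          as [K2 T2]; auto.
        * intros i j Hi Hj; rewrite HM; auto; ring.
        * intros i j Hi Hj; rewrite HC; auto; ring.
        * intros x; rewrite qform_sub_rank_one.
          set (L := sumR n (fun j => C r j * x j)).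
          replace (sumR n (fun i => v i * x i)) with (/ sqrt (C r r) * L).
          2: { unfold L; rewrite <- sumR_scal; apply sumR_ext; intros; unfold v; field; lra. }
          (* This multiple minimizes the form of [C] along the [r]-th coordinate, and the minimum is
             the form of the Schur complement. *)
          assert (H := HP (fun i => x i + (- L / C r r) * (if Nat.eqb i r then 1 else 0))).
          rewrite qform_add_coord in H; auto; fold L in H.
          replace ((/ sqrt (C r r) * L) ^ 2) with (L * L / C r r).
          2: { rewrite <- Hs at 1; field; lra. }
          replace (qform n C x - L * L / C r r) with
            (qform n C x + 2 * (- L / C r r) * L + - L / C r r * (- L / C r r) * C r r); auto.
          field; lra.
        * intros i j Hi Hj; unfold v.
          destruct (Nat.eq_dec i r) as [->|Hir].
          -- replace (C r r / sqrt (C r r)) with (sqrt (C r r)) by (rewrite <- Hs at 2; field; lra).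
             field; lra.
          -- assert (Hi' : (i < n - S d)%nat) by (unfold r in *; lia).
             rewrite (HC r i), !(H0 i) by lia; unfold Rdiv; ring.
        * assert (E : forall p, Tp n p (fun i j => M i j + v i * v j + (C i j - v i * v j)) =
              Tp n p (fun i j => M i j + C i j)).
          { intros p; apply Tp_ext; intros; ring. }
          split; intros p Hp; [intros Hpk; rewrite <- E; auto|].
          rewrite <- E; apply Rle_trans with (Tp n p (fun i j => M i j + v i * v j)); auto. }
  apply (main n); auto; intros; lia.
Qed.

(** If [T_(p+1) (M) <= 0 < T_p (M)], then positivity of [s T_p + T_(p+1)] and of
    [s T_(p+1) + T_(p+2)] would force [T_p T_(p+2) > T_(p+1)^2], against Newton. The second sum has
    degree [p + 2 <= m], hence the loss of one degree. *)
Lemma k_positive_unblock n m s M : symmetric n M -> (m <= n)%nat ->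
  k_positive (S n) m (block s M) -> k_positive n (m - 1) M.
Proof.
  intros HM Hm HK.
  assert (H : forall p, (p <= m - 1)%nat -> 0 < Tp n p M).
  { induction p as [|p IH]; intros Hp; [rewrite Tp_0; lra|].
    specialize (IH ltac:(lia)).
    assert (H1 := k_positive_0 _ _ _ (S p) HK ltac:(lia)).
    assert (H2 := k_positive_0 _ _ _ (S (S p)) HK ltac:(lia)).
    assert (N := Tp_newton n (S p) M HM ltac:(lia) ltac:(lia)).
    simpl Nat.sub in N; rewrite Nat.sub_0_r in N.
    rewrite Tp_block in H1, H2; nra. }
  intros p _ Hp; auto.
Qed.

(** Positivity descends from degree [m]: by Newton [T_(p+2) <= T_(p+1)^2 / T_p], so
    [s T_(p+1) + T_(p+2) > 0] gives [s T_p + T_(p+1) > 0]. *)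
Lemma k_positive_block n m s M : symmetric n M -> (m <= n)%nat ->
  k_positive n (m - 1) M -> 0 < Tp (S n) m (block s M) -> k_positive (S n) m (block s M).
Proof.
  intros HM Hm HK HT.
  assert (H : forall d, (d < m)%nat -> 0 < Tp (S n) (m - d) (block s M)).
  { induction d as [|d IH]; intros Hd; [rewrite Nat.sub_0_r; auto|].
    specialize (IH ltac:(lia)).
    remember (m - S d)%nat as q; destruct q as [|p]; [lia|].
    replace (m - d)%nat with (S (S p)) in IH by lia.
    assert (H1 := k_positive_0 _ _ _ p HK ltac:(lia)).
    assert (H2 := k_positive_0 _ _ _ (S p) HK ltac:(lia)).
    assert (N := Tp_newton n (S p) M HM ltac:(lia) ltac:(lia)).
    simpl Nat.sub in N; rewrite Nat.sub_0_r in N.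
    rewrite Tp_block in IH |- *; nra. }
  intros p Hp1 Hp; replace p with (m - (m - p))%nat by lia; apply H; lia.
Qed.

(** On the cone Newton's inequality makes the quotients [T_p / T_(p-1)] nonincreasing in [p], so all
    of them are at least the last one, which is at least [nu / B]. Multiplying them up from
    [T_0 = 1] gives the bound; [ratio] is the monotonicity with denominators cleared. *)
Lemma Tp_lower_bound n m M nu B : symmetric n M -> (m <= n)%nat ->
  k_positive n m M -> 0 < nu -> 0 < B -> nu <= Tp n m M -> Tp n (m - 1) M <= B ->
  forall p, (p <= m)%nat -> (nu / B) ^ p <= Tp n p M.
Proof.
  intros HM Hm HK Hnu HB H1 H2.
  assert (pos : forall p, (p <= m)%nat -> 0 < Tp n p M) by (intros; eapply k_positive_0; eauto).
  assert (ratio : forall d, (d < m)%nat ->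
    Tp n m M * Tp n (m - d - 1) M <= Tp n (m - d) M * Tp n (m - 1) M).
  { induction d as [|d IH]; intros Hd; [rewrite !Nat.sub_0_r; lra|].
    specialize (IH ltac:(lia)).
    remember (m - S d)%nat as q; destruct q as [|p]; [lia|].
    replace (m - d)%nat with (S (S p)) in IH by lia.
    simpl Nat.sub in *; rewrite ?Nat.sub_0_r in *.
    assert (N := Tp_newton n (S p) M HM ltac:(lia) ltac:(lia)).
    simpl Nat.sub in N; rewrite Nat.sub_0_r in N.
    assert (P1 := pos p ltac:(lia)); assert (P2 := pos (S p) ltac:(lia)).
    assert (P3 := pos (m - 1)%nat ltac:(lia)); assert (P4 := pos m ltac:(lia)).
    apply Rmult_le_reg_l with (Tp n (S p) M); auto.
    apply Rle_trans with (Tp n p M * (Tp n (S (S p)) M * Tp n (m - 1) M)).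
    - replace (Tp n (S p) M * (Tp n m M * Tp n p M)) with
        (Tp n p M * (Tp n m M * Tp n (S p) M)) by ring.
      apply Rmult_le_compat_l; lra.
    - replace (Tp n p M * (Tp n (S (S p)) M * Tp n (m - 1) M)) with
        (Tp n (m - 1) M * (Tp n (S (S p)) M * Tp n p M)) by ring.
      replace (Tp n (S p) M * (Tp n (S p) M * Tp n (m - 1) M)) with
        (Tp n (m - 1) M * (Tp n (S p) M * Tp n (S p) M)) by ring.
      apply Rmult_le_compat_l; lra. }
  assert (Hc : 0 < nu / B) by (apply Rdiv_lt_0_compat; auto).
  induction p as [|p IH]; intros Hp; [rewrite Tp_0; simpl; lra|].
  specialize (IH ltac:(lia)).
  assert (Hr := ratio (m - S p)%nat ltac:(lia)).
  replace (m - (m - S p))%nat with (S p) in Hr by lia.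
  simpl Nat.sub in Hr; rewrite Nat.sub_0_r in Hr.
  assert (P1 := pos p ltac:(lia)); assert (P2 := pos (S p) ltac:(lia)).
  simpl pow; apply Rle_trans with (nu / B * Tp n p M).
  - apply Rmult_le_compat_l; lra.
  - apply Rmult_le_reg_r with B; auto.
    replace (nu / B * Tp n p M * B) with (nu * Tp n p M) by (field; lra).
    apply Rle_trans with (Tp n m M * Tp n p M); [apply Rmult_le_compat_r; lra|].
    apply Rle_trans with (Tp n (S p) M * Tp n (m - 1) M); auto.
    apply Rmult_le_compat_l; lra.
Qed.

(** * Boundedness and continuity of [Tp] *)

Lemma det_bounded k B : exists C, 0 <= C /\
  forall M : Mat, (forall i j, Rabs (M i j) <= B) -> Rabs (det k M) <= C.
Proof.
  induction k as [|k [C [HC IH]]].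
  - exists 1; split; [lra|]; intros M _; simpl; rewrite Rabs_R1; lra.
  - assert (H : forall q, exists C', 0 <= C' /\ forall M : Mat, (forall i j, Rabs (M i j) <= B) ->
      Rabs (sumR q (fun j => (-1) ^ j * M O j * det k (minor j M))) <= C').
    { induction q as [|q [C' [HC' IHq]]].
      - exists 0; split; [lra|]; intros; simpl; rewrite Rabs_R0; lra.
      - exists (C' + Rabs B * C); split; [assert (H := Rabs_pos B); nra|].
        intros M HB; simpl; eapply Rle_trans; [apply Rabs_triang|].
        apply Rplus_le_compat; auto; rewrite !Rabs_mult, pow_1_abs, Rmult_1_l.
        apply Rmult_le_compat; try apply Rabs_pos.
        + eapply Rle_trans; [apply HB|apply Rle_abs].
        + apply IH; intros i j; apply HB. }
    apply H.
Qed.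

(** The inductions on [det] pass to minors and assume their hypothesis for all indices, while
    hypotheses on matrices concern only indices below [n]; truncation reconciles the two without
    changing [Tp]. *)
Definition truncate (n : nat) (M : Mat) : Mat :=
  fun i j => if Nat.ltb i n then if Nat.ltb j n then M i j else 0 else 0.

Lemma Tp_truncate n p M : Tp n p (truncate n M) = Tp n p M.
Proof.
  apply Tp_ext; intros i j Hi Hj; unfold truncate.
  apply Nat.ltb_lt in Hi, Hj; rewrite Hi, Hj; auto.
Qed.

Lemma Tp_bounded n p B : exists C, 0 <= C /\
  forall M : Mat, (forall i j, (i < n)%nat -> (j < n)%nat -> Rabs (M i j) <= B) ->
    Rabs (Tp n p M) <= C.
Proof.
  assert (H : forall L : list (list nat), exists C, 0 <= C /\
    forall M : Mat, (forall i j, Rabs (M i j) <= Rmax 0 B) ->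
      Rabs (fold_right Rplus 0 (map (fun I => principal_minor I M) L)) <= C).
  { induction L as [|I L [C [HC IH]]].
    - exists 0; split; [lra|]; intros; simpl; rewrite Rabs_R0; lra.
    - destruct (det_bounded (length I) (Rmax 0 B)) as [D [HD HI]].
      exists (D + C); split; [lra|]; intros M HM; simpl.
      eapply Rle_trans; [apply Rabs_triang|].
      apply Rplus_le_compat; auto; apply HI; auto. }
  destruct (H (subsets (seq 0 n) p)) as [C [HC HT]]; exists C; split; auto.
  intros M HM; rewrite <- Tp_truncate; apply HT; intros i j; unfold truncate.
  assert (H0 := Rmax_l 0 B); assert (H1 := Rmax_r 0 B).
  destruct (Nat.ltb_spec i n), (Nat.ltb_spec j n); rewrite ?Rabs_R0; auto.
  eapply Rle_trans; [apply HM; auto|auto].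
Qed.

Lemma cont_on_cyl_const n D c : cont_on_cyl n D (fun _ _ => c).
Proof.
  intros x t _ _ eps He; exists 1; split; [lra|]; intros.
  rewrite Rminus_diag, Rabs_R0; auto.
Qed.

Lemma cont_on_cyl_plus n D g h : cont_on_cyl n D g -> cont_on_cyl n D h ->
  cont_on_cyl n D (fun x t => g x t + h x t).
Proof.
  intros Hg Hh x t Hx Ht eps He.
  destruct (Hg x t Hx Ht (eps / 2)) as [d1 [Hd1 H1]]; [lra|].
  destruct (Hh x t Hx Ht (eps / 2)) as [d2 [Hd2 H2]]; [lra|].
  exists (Rmin d1 d2); split; [apply Rmin_pos; auto|].
  intros y s Hy Hs Hd Hst; assert (M1 := Rmin_l d1 d2); assert (M2 := Rmin_r d1 d2).
  specialize (H1 y s Hy Hs ltac:(lra) ltac:(lra)).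
  specialize (H2 y s Hy Hs ltac:(lra) ltac:(lra)).
  replace (g y s + h y s - (g x t + h x t)) with ((g y s - g x t) + (h y s - h x t)) by ring.
  eapply Rle_lt_trans; [apply Rabs_triang|lra].
Qed.

Lemma cont_on_cyl_mult n D g h : cont_on_cyl n D g -> cont_on_cyl n D h ->
  cont_on_cyl n D (fun x t => g x t * h x t).
Proof.
  intros Hg Hh x t Hx Ht eps He.
  pose (A := Rabs (g x t) + Rabs (h x t) + 1).
  assert (HA : 1 <= A) by (unfold A; assert (a := Rabs_pos (g x t)); assert (b := Rabs_pos (h x t)); lra).
  pose (e := Rmin 1 (eps / (2 * A))).
  assert (He1 : e <= 1) by apply Rmin_l.
  assert (He2 : e <= eps / (2 * A)) by apply Rmin_r.
  assert (He0 : 0 < e) by (apply Rmin_pos; [lra|apply Rdiv_lt_0_compat; lra]).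
  assert (HeA : e * (2 * A) <= eps).
  { apply Rle_trans with (eps / (2 * A) * (2 * A)); [apply Rmult_le_compat_r; lra|].
    right; field; lra. }
  destruct (Hg x t Hx Ht e He0) as [d1 [Hd1 H1]].
  destruct (Hh x t Hx Ht e He0) as [d2 [Hd2 H2]].
  exists (Rmin d1 d2); split; [apply Rmin_pos; auto|].
  intros y s Hy Hs Hd Hst; assert (M1 := Rmin_l d1 d2); assert (M2 := Rmin_r d1 d2).
  specialize (H1 y s Hy Hs ltac:(lra) ltac:(lra)).
  specialize (H2 y s Hy Hs ltac:(lra) ltac:(lra)).
  replace (g y s * h y s - g x t * h x t) with
    ((g y s - g x t) * (h y s - h x t) + ((g y s - g x t) * h x t + g x t * (h y s - h x t))) by ring.
  eapply Rle_lt_trans; [apply Rabs_triang|].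
  eapply Rle_lt_trans; [apply Rplus_le_compat_l, Rabs_triang|].
  rewrite !Rabs_mult.
  assert (a := Rabs_pos (g x t)); assert (b := Rabs_pos (h x t)).
  assert (c := Rabs_pos (g y s - g x t)); assert (d := Rabs_pos (h y s - h x t)).
  unfold A in *; nra.
Qed.

Lemma cont_on_cyl_det n D k (M : Rn -> R -> Mat) :
  (forall i j, cont_on_cyl n D (fun x t => M x t i j)) ->
  cont_on_cyl n D (fun x t => det k (M x t)).
Proof.
  revert M; induction k as [|k IH]; intros M HM; [apply (cont_on_cyl_const n D 1)|].
  assert (H : forall q, cont_on_cyl n D (fun x t =>
    sumR q (fun j => (-1) ^ j * M x t O j * det k (minor j (M x t))))).
  { induction q as [|q IHq]; [apply (cont_on_cyl_const n D 0)|]; simpl.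
    apply cont_on_cyl_plus; auto; apply cont_on_cyl_mult.
    - apply cont_on_cyl_mult; auto; apply cont_on_cyl_const.
    - apply (IH (fun x t => minor q (M x t))); intros i j; unfold minor; auto. }
  apply H.
Qed.

Lemma cont_on_cyl_Tp n D k p (M : Rn -> R -> Mat) :
  (forall i j, (i < k)%nat -> (j < k)%nat -> cont_on_cyl n D (fun x t => M x t i j)) ->
  cont_on_cyl n D (fun x t => Tp k p (M x t)).
Proof.
  intros HM.
  assert (H : cont_on_cyl n D (fun x t => Tp k p (truncate k (M x t)))).
  { assert (HM' : forall i j, cont_on_cyl n D (fun x t => truncate k (M x t) i j)).
    { intros i j; unfold truncate; destruct (Nat.ltb_spec i k), (Nat.ltb_spec j k);
        auto; apply cont_on_cyl_const. }
    unfold Tp; induction (subsets (seq 0 k) p) as [|I L IHL]; simpl; [apply cont_on_cyl_const|].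
    apply cont_on_cyl_plus; auto; apply cont_on_cyl_det; intros; apply HM'. }
  intros x t Hx Ht eps He; destruct (H x t Hx Ht eps He) as [d [Hd Hc]].
  exists d; split; auto; intros y s Hy Hs Hyx Hst.
  specialize (Hc y s Hy Hs Hyx Hst); rewrite !Tp_truncate in Hc; auto.
Qed.

(** * Second order calculus from partial derivatives *)

Lemma sumR_le k g h : (forall i, (i < k)%nat -> g i <= h i) -> sumR k g <= sumR k h.
Proof.
  intros E; induction k as [|k IH]; simpl; [lra|].
  apply Rplus_le_compat; auto.
Qed.

Lemma sumR_ge0 k g : (forall i, (i < k)%nat -> 0 <= g i) -> 0 <= sumR k g.
Proof. intros E; rewrite <- (sumR_0 k (fun _ => 0)) by auto; apply sumR_le; auto. Qed.

Lemma term_le_sumR k g r : (forall i, (i < k)%nat -> 0 <= g i) -> (r < k)%nat -> g r <= sumR k g.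
Proof.
  intros E Hr; induction k as [|k IH]; [lia|]; simpl.
  assert (H := sumR_ge0 k g ltac:(auto)); assert (H1 := E k ltac:(lia)).
  destruct (Nat.eq_dec r k) as [->|Hn]; [lra|].
  specialize (IH ltac:(auto) ltac:(lia)); lra.
Qed.

Lemma normn_coord n x i : (i < n)%nat -> Rabs (x i) <= normn n x.
Proof.
  intros Hi; unfold normn; rewrite <- sqrt_Rsqr_abs; apply sqrt_le_1_alt.
  replace (Rsqr (x i)) with ((fun i => x i ^ 2) i) by (unfold Rsqr; simpl; ring).
  apply (term_le_sumR n (fun i => x i ^ 2)); auto; intros; apply pow2_ge_0.
Qed.

Lemma distn_coord n x y i : (i < n)%nat -> Rabs (y i - x i) <= distn n y x.
Proof. apply (normn_coord n (fun i => y i - x i)). Qed.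

Lemma distn_le n x y d : (forall i, (i < n)%nat -> Rabs (y i - x i) <= d) -> 0 <= d ->
  distn n y x <= INR n * d.
Proof.
  intros H Hd; unfold distn, normn.
  assert (H1 : sumR n (fun i => (y i - x i) ^ 2) <= INR n * (d * d)).
  { clear - H; induction n as [|n IH]; [simpl; lra|].
    rewrite S_INR.
    change (sumR n (fun i => (y i - x i) ^ 2) + (y n - x n) ^ 2 <= (INR n + 1) * (d * d)).
    assert (Hn := H n ltac:(lia)); specialize (IH ltac:(auto)).
    assert ((y n - x n) ^ 2 <= d * d).
    { rewrite <- (pow2_abs (y n - x n)); assert (a := Rabs_pos (y n - x n)); simpl; nra. }
    lra. }
  rewrite <- (sqrt_Rsqr (INR n * d)) by (apply Rmult_le_pos; [apply pos_INR|auto]).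
  apply sqrt_le_1_alt; eapply Rle_trans; [apply H1|]; unfold Rsqr.
  destruct n as [|n]; [simpl; lra|].
  assert (1 <= INR (S n)) by (rewrite S_INR; assert (a := pos_INR n); lra).
  assert (0 <= d * d) by nra.
  replace (INR (S n) * d * (INR (S n) * d)) with (INR (S n) * (INR (S n) * (d * d))) by ring.
  apply Rmult_le_compat_l; [lra|]; nra.
Qed.

Lemma distn_refl n x : distn n x x = 0.
Proof.
  unfold distn, normn; rewrite sumR_0; [apply sqrt_0|]; intros; ring.
Qed.

Lemma upd_same x i s : upd x i s i = s.
Proof. unfold upd; rewrite Nat.eqb_refl; auto. Qed.

Lemma upd_other x i j s : j <> i -> upd x i s j = x j.
Proof. intros H; unfold upd; apply Nat.eqb_neq in H; rewrite H; auto. Qed.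

Lemma upd_id x i : upd x i (x i) = x.
Proof.
  extensionality j; destruct (Nat.eq_dec j i) as [->|H].
  - apply upd_same.
  - apply upd_other; auto.
Qed.

Lemma upd_upd x i s r : upd (upd x i s) i r = upd x i r.
Proof. extensionality j; unfold upd; destruct (Nat.eqb j i); auto. Qed.

Lemma upd_comm x i j s r : i <> j -> upd (upd x i s) j r = upd (upd x j r) i s.
Proof.
  intros H; extensionality k; unfold upd.
  destruct (Nat.eqb_spec k i), (Nat.eqb_spec k j); auto; congruence.
Qed.

Lemma in_Rn_upd n x i s : in_Rn n x -> (i < n)%nat -> in_Rn n (upd x i s).
Proof. intros H Hi j Hj; rewrite upd_other; [apply H; auto|lia]. Qed.

(** The mean value inequality for [g - l s] in the [i]-th coordinate. Every later estimate of an
    increment by partial derivatives reduces to it. *)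
Lemma partial_increment g i D l eps x s1 :
  (forall s, Rabs (s - x i) <= Rabs (s1 - x i) ->
     has_partial g i (upd x i s) (D (upd x i s)) /\ Rabs (D (upd x i s) - l) <= eps) ->
  Rabs (g (upd x i s1) - g x - l * (s1 - x i)) <= eps * Rabs (s1 - x i).
Proof.
  intros H.
  assert (B := Coquelicot.Derive.bounded_variation (fun s => g (upd x i s) - l * s)
                 (fun s => D (upd x i s) - l) eps (x i) s1).
  simpl in B; rewrite upd_id in B.
  replace (g (upd x i s1) - g x - l * (s1 - x i)) with
    (g (upd x i s1) - l * s1 - (g x - l * x i)) by ring.
  apply B; intros s Hs; destruct (H s Hs) as [H1 H2]; split; auto.
  apply Coquelicot.Derive.is_derive_Reals; apply derivable_pt_lim_minus.
  - unfold has_partial in H1; rewrite upd_same in H1.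
    replace (fun s0 => g (upd x i s0)) with (fun s0 => g (upd (upd x i s) i s0)); auto.
    extensionality r; rewrite upd_upd; auto.
  - replace l with (l * 1) at 2 by ring; apply (derivable_pt_lim_scal id); apply derivable_pt_lim_id.
Qed.

Lemma open_box n O x : is_open n O -> O x -> exists r, 0 < r /\
  forall y, in_Rn n y -> (forall i, (i < n)%nat -> Rabs (y i - x i) <= r) -> O y.
Proof.
  intros [H1 H2] Hx; destruct (H2 x Hx) as [r [Hr H]].
  assert (Hn : 0 <= INR n) by apply pos_INR.
  exists (r / (INR n + 1)); split; [apply Rdiv_lt_0_compat; lra|].
  intros y Hy Hyx; apply H; auto.
  eapply Rle_lt_trans; [apply distn_le; [apply Hyx|]|].
  - apply Rlt_le, Rdiv_lt_0_compat; lra.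
  - apply Rmult_lt_reg_r with (INR n + 1); [lra|].
    replace (INR n * (r / (INR n + 1)) * (INR n + 1)) with (INR n * r) by (field; lra); nra.
Qed.

Lemma cont_box n O D x : is_open n O -> O x -> cont_on n O D -> forall eps, 0 < eps ->
  exists r, 0 < r /\ forall y, in_Rn n y -> (forall i, (i < n)%nat -> Rabs (y i - x i) <= r) ->
    O y /\ Rabs (D y - D x) <= eps.
Proof.
  intros HO Hx HD eps He; destruct (open_box n O x HO Hx) as [r1 [Hr1 H1]].
  destruct (HD x Hx eps He) as [r [Hr H]].
  assert (Hn : 0 <= INR n) by apply pos_INR.
  exists (Rmin r1 (r / (INR n + 1))); split; [apply Rmin_pos; auto; apply Rdiv_lt_0_compat; lra|].
  intros y Hy Hyx.
  assert (Oy : O y).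
  { apply H1; auto; intros i Hi; eapply Rle_trans; [apply Hyx; auto|apply Rmin_l]. }
  split; auto; apply Rlt_le, H; auto.
  eapply Rle_lt_trans; [apply distn_le with (d := r / (INR n + 1))|].
  - intros i Hi; eapply Rle_trans; [apply Hyx; auto|apply Rmin_r].
  - apply Rlt_le, Rdiv_lt_0_compat; lra.
  - apply Rmult_lt_reg_r with (INR n + 1); [lra|].
    replace (INR n * (r / (INR n + 1)) * (INR n + 1)) with (INR n * r) by (field; lra); nra.
Qed.

Lemma cont_box_all n O (D : nat -> Rn -> R) x k : is_open n O -> O x ->
  (forall i, (i < k)%nat -> cont_on n O (D i)) -> forall eps, 0 < eps ->
  exists r, 0 < r /\ forall y, in_Rn n y -> (forall i, (i < n)%nat -> Rabs (y i - x i) <= r) ->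
    O y /\ forall i, (i < k)%nat -> Rabs (D i y - D i x) <= eps.
Proof.
  intros HO Hx HD eps He; induction k as [|k IH].
  - destruct (open_box n O x HO Hx) as [r [Hr H]]; exists r; split; auto.
    intros y Hy Hyx; split; auto; intros; lia.
  - destruct IH as [r1 [Hr1 H1]]; [auto|].
    destruct (cont_box n O (D k) x HO Hx (HD k ltac:(lia)) eps He) as [r2 [Hr2 H2]].
    exists (Rmin r1 r2); split; [apply Rmin_pos; auto|]; intros y Hy Hyx.
    destruct (H1 y Hy) as [Oy E1].
    { intros i Hi; eapply Rle_trans; [apply Hyx; auto|apply Rmin_l]. }
    destruct (H2 y Hy) as [_ E2].
    { intros i Hi; eapply Rle_trans; [apply Hyx; auto|apply Rmin_r]. }
    split; auto; intros i Hi; destruct (Nat.eq_dec i k) as [->|]; auto; apply E1; lia.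
Qed.

Definition line (x xi : Rn) (s : R) : Rn := fun i => x i + s * xi i.

(** The coordinates are moved one at a time: [z k] has the first [k] of them moved, all these points
    stay in the box, and the errors of the steps add up. *)
Lemma differentiable_estimate n O g D x : is_open n O -> O x ->
  (forall y i, O y -> (i < n)%nat -> has_partial g i y (D i y)) ->
  (forall i, (i < n)%nat -> cont_on n O (D i)) -> forall eps, 0 < eps ->
  exists r, 0 < r /\ forall h, in_Rn n h -> (forall i, Rabs (h i) <= r) ->
    Rabs (g (line x h 1) - g x - sumR n (fun i => D i x * h i)) <= eps * sumR n (fun i => Rabs (h i)).
Proof.
  intros HO Hx Hg HD eps He.
  destruct (cont_box_all n O D x n HO Hx HD eps He) as [r [Hr H]].
  assert (Rx : in_Rn n x) by (apply HO; auto).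
  exists r; split; auto; intros h Hh Hhr.
  pose (z := fun k i => if Nat.ltb i k then x i + h i else x i).
  assert (main : forall k, (k <= n)%nat ->
     Rabs (g (z k) - g x - sumR k (fun i => D i x * h i)) <= eps * sumR k (fun i => Rabs (h i))).
  { induction k as [|k IH]; intros Hk.
    - replace (z 0%nat) with x by (extensionality i; unfold z; auto); simpl.
      replace (g x - g x - 0) with 0 by ring; rewrite Rabs_R0; lra.
    - specialize (IH ltac:(lia)); simpl.
      assert (zk : z k k = x k) by (unfold z; rewrite Nat.ltb_irrefl; auto).
      assert (E : z (S k) = upd (z k) k (x k + h k)).
      { extensionality i; unfold z, upd.
        destruct (Nat.ltb_spec i (S k)), (Nat.eqb_spec i k), (Nat.ltb_spec i k); subst; auto; lia. }
      assert (P := partial_increment g k (D k) (D k x) eps (z k) (x k + h k)).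
      rewrite zk, <- E in P; replace (x k + h k - x k) with (h k) in P by ring.
      assert (P' : Rabs (g (z (S k)) - g (z k) - D k x * h k) <= eps * Rabs (h k)).
      { apply P; intros s Hs.
        destruct (H (upd (z k) k s)) as [Oy Dy].
        - apply in_Rn_upd; [|lia]; intros i Hi; unfold z.
          destruct (Nat.ltb_spec i k); [lia|apply Rx; auto].
        - intros i Hi; destruct (Nat.eq_dec i k) as [->|Hik].
          + rewrite upd_same; eapply Rle_trans; [apply Hs|apply Hhr].
          + rewrite upd_other by auto; unfold z; destruct (Nat.ltb_spec i k).
            * replace (x i + h i - x i) with (h i) by ring; auto.
            * rewrite Rminus_diag, Rabs_R0; lra.
        - split; [apply Hg; auto; lia|apply Dy; lia]. }
      replace (g (z (S k)) - g x - (sumR k (fun i => D i x * h i) + D k x * h k)) with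
        ((g (z k) - g x - sumR k (fun i => D i x * h i)) + (g (z (S k)) - g (z k) - D k x * h k)) by ring.
      eapply Rle_trans; [apply Rabs_triang|]; lra. }
  replace (line x h 1) with (z n); auto.
  extensionality i; unfold z, line; destruct (Nat.ltb_spec i n); [ring|].
  rewrite (Hh i) by auto; ring.
Qed.

Lemma directional_derivative n O g D x xi : is_open n O -> O x -> in_Rn n xi ->
  (forall y i, O y -> (i < n)%nat -> has_partial g i y (D i y)) ->
  (forall i, (i < n)%nat -> cont_on n O (D i)) ->
  derivable_pt_lim (fun s => g (line x xi s)) 0 (sumR n (fun i => xi i * D i x)).
Proof.
  intros HO Hx Hxi Hg HD eps He.
  (* The summand 1 keeps [A] positive, so that [xi = 0] needs no separate case. *)
  pose (A := sumR n (fun i => Rabs (xi i)) + 1).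
  assert (HA : 1 <= A).
  { unfold A; assert (0 <= sumR n (fun i => Rabs (xi i))) by (apply sumR_ge0; intros; apply Rabs_pos); lra. }
  destruct (differentiable_estimate n O g D x HO Hx Hg HD (eps / (2 * A))) as [r [Hr H]].
  { apply Rdiv_lt_0_compat; lra. }
  assert (Hd : 0 < r / A) by (apply Rdiv_lt_0_compat; lra).
  exists (mkposreal _ Hd); intros h Hh Hhr; simpl in Hhr.
  assert (hA : Rabs h * A <= r).
  { apply Rmult_le_reg_r with (/ A); [apply Rinv_0_lt_compat; lra|].
    rewrite Rmult_assoc, Rinv_r by lra; unfold Rdiv in Hhr; lra. }
  assert (Hxi_le : forall i, Rabs (xi i) <= A).
  { intros i; destruct (Nat.lt_ge_cases i n) as [Hi|Hi].
    - assert (Hs := term_le_sumR n (fun i => Rabs (xi i)) i ltac:(intros; apply Rabs_pos) Hi).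
      simpl in Hs; unfold A; lra.
    - rewrite Hxi, Rabs_R0 by auto; lra. }
  specialize (H (fun i => h * xi i)).
  replace (line x (fun i => h * xi i) 1) with (line x xi h) in H
    by (extensionality i; unfold line; ring).
  replace (sumR n (fun i => D i x * (h * xi i))) with (h * sumR n (fun i => xi i * D i x)) in H.
  2: { rewrite <- sumR_scal; apply sumR_ext; intros; ring. }
  replace (sumR n (fun i => Rabs (h * xi i))) with (Rabs h * (A - 1)) in H.
  2: { unfold A; replace (sumR n (fun i => Rabs (xi i)) + 1 - 1) with (sumR n (fun i => Rabs (xi i))) by ring.
       rewrite <- sumR_scal; apply sumR_ext; intros; rewrite Rabs_mult; ring. }
  rewrite Rplus_0_l; replace (line x xi 0) with x by (extensionality i; unfold line; ring).
  set (L := sumR n (fun i => xi i * D i x)) in *.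
  replace ((g (line x xi h) - g x) / h - L) with ((g (line x xi h) - g x - h * L) / h) by (field; auto).
  assert (h0 := Rabs_pos_lt h Hh).
  unfold Rdiv; rewrite Rabs_mult, Rabs_inv.
  apply Rmult_lt_reg_r with (Rabs h); auto.
  rewrite Rmult_assoc, Rinv_l, Rmult_1_r by lra.
  eapply Rle_lt_trans; [apply H|].
  - intros i Hi; rewrite Hxi by auto; ring.
  - intros i; rewrite Rabs_mult; eapply Rle_trans; [|apply hA].
    apply Rmult_le_compat_l; [lra|auto].
  - replace (eps / (2 * A) * (Rabs h * (A - 1))) with (eps * Rabs h * ((A - 1) / (2 * A))) by (field; lra).
    assert ((A - 1) / (2 * A) < 1).
    { apply Rmult_lt_reg_r with (2 * A); [lra|].
      unfold Rdiv; rewrite Rmult_assoc, Rinv_l by lra; lra. }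
    assert (0 < eps * Rabs h) by (apply Rmult_lt_0_compat; lra).
    nra.
Qed.

(** In the symmetric sum [phi s + phi (- s)] the first order term at 0 cancels. If [l < 0], its
    derivative [dphi c - dphi (- c)] is negative for small [c > 0], and the sum would drop below
    [2 * phi 0]. *)
Lemma second_derivative_ge0 (phi dphi : R -> R) l r : 0 < r ->
  (forall s, Rabs s < r -> derivable_pt_lim phi s (dphi s)) ->
  derivable_pt_lim dphi 0 l -> (forall s, Rabs s < r -> phi 0 <= phi s) -> 0 <= l.
Proof.
  intros Hr H1 H2 Hmin; apply Rnot_lt_le; intros Hl.
  destruct (H2 (- l / 2)) as [d Hd]; [lra|].
  pose (s := Rmin r d / 2); assert (Hm : 0 < Rmin r d) by (apply Rmin_pos; [auto|apply cond_pos]).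
  assert (m1 := Rmin_l r d); assert (m2 := Rmin_r r d).
  assert (Hs : 0 < s) by (unfold s; lra).
  destruct (MVT_cor2 (fun s => phi s + phi (- s)) (fun s => dphi s - dphi (- s)) 0 s Hs) as [c [Hc1 Hc2]].
  - intros c Hc; replace (dphi c - dphi (- c)) with (dphi c + - 1 * dphi (- c)) by ring.
    apply derivable_pt_lim_plus.
    + apply H1; rewrite Rabs_right; unfold s in *; lra.
    + replace (-1 * dphi (- c)) with (dphi (- c) * -1) by ring.
      apply (derivable_pt_lim_comp Ropp phi).
      * apply (derivable_pt_lim_opp id), derivable_pt_lim_id.
      * apply H1; rewrite Rabs_Ropp, Rabs_right; unfold s in *; lra.
  - rewrite Ropp_0 in Hc1.
    assert (p1 := Hmin s); assert (p2 := Hmin (- s)).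
    rewrite Rabs_Ropp, Rabs_right in p2 by lra; rewrite Rabs_right in p1 by lra.
    specialize (p1 ltac:(unfold s in *; lra)); specialize (p2 ltac:(unfold s in *; lra)).
    assert (e1 := Hd c ltac:(lra) ltac:(rewrite Rabs_right; unfold s in *; lra)).
    assert (e2 := Hd (- c) ltac:(lra) ltac:(rewrite Rabs_Ropp, Rabs_right; unfold s in *; lra)).
    rewrite Rplus_0_l in e1, e2.
    apply Rabs_def2 in e1, e2.
    assert (f1 : dphi c - dphi 0 < l / 2 * c).
    { replace (dphi c - dphi 0) with ((dphi c - dphi 0) / c * c) by (field; lra).
      apply Rmult_lt_compat_r; lra. }
    assert (f2 : - (dphi (- c) - dphi 0) < l / 2 * c).
    { replace (- (dphi (- c) - dphi 0)) with ((dphi (- c) - dphi 0) / - c * c) by (field; lra).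
      apply Rmult_lt_compat_r; lra. }
    assert (dphi c - dphi (- c) < 0) by nra.
    nra.
Qed.

Lemma hessian_psd_at_min n O g D H x : is_open n O -> O x ->
  (forall y i, O y -> (i < n)%nat -> has_partial g i y (D i y)) ->
  (forall y i j, O y -> (i < n)%nat -> (j < n)%nat -> has_partial (D j) i y (H y i j)) ->
  (forall i, (i < n)%nat -> cont_on n O (D i)) ->
  (forall i j, (i < n)%nat -> (j < n)%nat -> cont_on n O (fun y => H y i j)) ->
  symmetric n (H x) -> (forall y, O y -> g x <= g y) -> psd n (H x).
Proof.
  intros HO Hx Hg HD cD cH sym Hmin xi0.
  (* [psd] ranges over all functions, whereas points of [O] vanish from index [n] on; the direction
     is therefore cut off, which the form does not notice. *)
  pose (xi := fun i => if Nat.ltb i n then xi0 i else 0).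
  assert (Hxi : in_Rn n xi).
  { intros i Hi; unfold xi; destruct (Nat.ltb_spec i n); auto; lia. }
  assert (xi_eq : forall i, (i < n)%nat -> xi i = xi0 i).
  { intros i Hi; unfold xi; apply Nat.ltb_lt in Hi; rewrite Hi; auto. }
  assert (Rx : in_Rn n x) by (apply HO; auto).
  destruct (open_box n O x HO Hx) as [r [Hr HB]].
  pose (A := sumR n (fun i => Rabs (xi i)) + 1).
  assert (HA : 1 <= A).
  { unfold A; assert (0 <= sumR n (fun i => Rabs (xi i))) by (apply sumR_ge0; intros; apply Rabs_pos); lra. }
  assert (line_O : forall s, Rabs s < r / A -> O (line x xi s)).
  { intros s Hs; apply HB.
    - intros i Hi; unfold line; rewrite Hxi, Rx by auto; ring.
    - intros i Hi; unfold line; replace (x i + s * xi i - x i) with (s * xi i) by ring.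
      rewrite Rabs_mult.
      assert (Hxs := term_le_sumR n (fun i => Rabs (xi i)) i ltac:(intros; apply Rabs_pos) Hi).
      simpl in Hxs; apply Rle_trans with (r / A * A); [|right; field; lra].
      apply Rmult_le_compat; try apply Rabs_pos; [lra|unfold A; lra]. }
  (* [directional_derivative] concerns the parameter 0 only; [shift] and [unshift] move the base
     point along the line to reach any other parameter. *)
  assert (shift : forall F s, derivable_pt_lim (fun h => F (line (line x xi s) xi h)) 0 =
    derivable_pt_lim (fun h => F (line x xi (s + h))) 0).
  { intros F s; f_equal; extensionality h; f_equal; extensionality i; unfold line; ring. }
  assert (unshift : forall F s l, derivable_pt_lim (fun h => F (s + h)) 0 l -> derivable_pt_lim F s l).
  { intros F s l HF e He; destruct (HF e He) as [d Hd]; exists d; intros h Hh Hhd.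
    specialize (Hd h Hh Hhd); rewrite !Rplus_0_l, Rplus_0_r in Hd; auto. }
  assert (Q : 0 <= sumR n (fun j => xi j * sumR n (fun i => xi i * H x i j))).
  { apply (second_derivative_ge0 (fun s => g (line x xi s))
      (fun s => sumR n (fun i => xi i * D i (line x xi s))) _ (r / A)).
    - apply Rdiv_lt_0_compat; lra.
    - intros s Hs; apply unshift; rewrite <- (shift g).
      apply (directional_derivative n O); auto.
    - assert (HDk : forall k, (k <= n)%nat ->
        derivable_pt_lim (fun s => sumR k (fun i => xi i * D i (line x xi s))) 0
          (sumR k (fun j => xi j * sumR n (fun i => xi i * H x i j)))).
      { induction k as [|k IH]; intros Hk; simpl; [apply derivable_pt_lim_const|].
        apply (derivable_pt_lim_plus (fun s => sumR k (fun i => xi i * D i (line x xi s)))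
                 (fun s => xi k * D k (line x xi s))); [apply IH; lia|].
        apply (derivable_pt_lim_scal (fun s => D k (line x xi s))).
        apply (directional_derivative n O (D k) (fun i y => H y i k)); auto. }
      apply HDk; auto.
    - intros s Hs; replace (line x xi 0) with x by (extensionality i; unfold line; ring); auto. }
  replace (qform n (H x) xi0) with (sumR n (fun j => xi j * sumR n (fun i => xi i * H x i j))); auto.
  apply sumR_ext; intros i Hi; rewrite <- sumR_scal; apply sumR_ext; intros j Hj.
  rewrite !xi_eq, (sym j i) by auto; ring.
Qed.

(** The mean value inequality is used twice: in the [i]-th coordinate for the increment of [g] in
    the [j]-th one, and then in the [j]-th coordinate for [D i]. *)
Lemma second_difference_estimate n O g D H x i j : is_open n O -> O x ->
  (i < n)%nat -> (j < n)%nat -> i <> j ->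
  (forall y k, O y -> (k < n)%nat -> has_partial g k y (D k y)) ->
  (forall y k l, O y -> (k < n)%nat -> (l < n)%nat -> has_partial (D l) k y (H y k l)) ->
  cont_on n O (fun y => H y j i) -> forall eps, 0 < eps ->
  exists r, 0 < r /\ forall h, 0 < h -> h <= r ->
    Rabs (g (upd (upd x i (x i + h)) j (x j + h)) - g (upd x i (x i + h))
          - g (upd x j (x j + h)) + g x - H x j i * h * h) <= eps * h * h.
Proof.
  intros HO Hx Hi Hj Hij Hg HD cH eps He.
  destruct (cont_box n O (fun y => H y j i) x HO Hx cH eps He) as [r [Hr HB]].
  assert (Rx : in_Rn n x) by (apply HO; auto).
  exists r; split; auto; intros h Hh Hhr.
  assert (near : forall s t, Rabs (s - x i) <= h -> Rabs (t - x j) <= h ->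
    O (upd (upd x i s) j t) /\ Rabs (H (upd (upd x i s) j t) j i - H x j i) <= eps).
  { intros s t Hs Ht; apply HB.
    - apply in_Rn_upd; auto; apply in_Rn_upd; auto.
    - intros k Hk; destruct (Nat.eq_dec k j) as [->|Hkj]; [rewrite upd_same; lra|].
      rewrite (upd_other _ j) by auto; destruct (Nat.eq_dec k i) as [->|Hki]; [rewrite upd_same; lra|].
      rewrite upd_other, Rminus_diag, Rabs_R0 by auto; lra. }
  assert (zero : forall a, Rabs (a - a) <= h) by (intros; rewrite Rminus_diag, Rabs_R0; lra).
  assert (near_i : forall s, Rabs (s - x i) <= h -> O (upd x i s)).
  { intros s Hs; destruct (near s (x j) Hs (zero _)) as [Hn _].
    replace (upd (upd x i s) j (x j)) with (upd x i s) in Hn; auto.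
    rewrite <- (upd_id (upd x i s) j) at 1; rewrite (upd_other x i j) by auto; auto. }
  pose (G := fun y => g (upd y j (x j + h)) - g y).
  pose (DG := fun y => D i (upd y j (x j + h)) - D i y).
  assert (P := partial_increment G i DG (H x j i * h) (eps * h) x (x i + h)).
  replace (x i + h - x i) with h in P by ring; rewrite (Rabs_right h) in P by lra.
  unfold G in P.
  replace (g (upd (upd x i (x i + h)) j (x j + h)) - g (upd x i (x i + h)) -
     g (upd x j (x j + h)) + g x - H x j i * h * h) with
    (g (upd (upd x i (x i + h)) j (x j + h)) - g (upd x i (x i + h)) -
     (g (upd x j (x j + h)) - g x) - H x j i * h * h) by ring.
  apply P; intros s Hs; split.
  - unfold DG, has_partial; apply derivable_pt_lim_minus.
    + destruct (near s (x j + h) Hs) as [On _].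
      { replace (x j + h - x j) with h by ring; rewrite Rabs_right; lra. }
      assert (Hp := Hg _ i On Hi); unfold has_partial in Hp.
      rewrite (upd_other _ j i) in Hp by auto; rewrite upd_same in *.
      replace (fun s0 => g (upd (upd (upd x i s) i s0) j (x j + h)))
        with (fun s0 => g (upd (upd (upd x i s) j (x j + h)) i s0)); auto.
      extensionality s0; f_equal; apply upd_comm; auto.
    + apply (Hg (upd x i s) i); auto.
  - unfold DG.
    assert (P2 := partial_increment (D i) j (fun y => H y j i) (H x j i) eps (upd x i s) (x j + h)).
    rewrite (upd_other x i j) in P2 by auto.
    replace (x j + h - x j) with h in P2 by ring; rewrite (Rabs_right h) in P2 by lra.
    apply P2; intros t Ht; destruct (near s t Hs Ht) as [On Hn]; split; auto.
Qed.

(** Schwarz's theorem: the mixed second difference is symmetric in the two coordinates, and divided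
    by [h * h] it is close to both mixed derivatives. *)
Lemma hessian_symmetric n O g D H x : is_open n O -> O x ->
  (forall y k, O y -> (k < n)%nat -> has_partial g k y (D k y)) ->
  (forall y k l, O y -> (k < n)%nat -> (l < n)%nat -> has_partial (D l) k y (H y k l)) ->
  (forall i j, (i < n)%nat -> (j < n)%nat -> cont_on n O (fun y => H y i j)) ->
  symmetric n (H x).
Proof.
  intros HO Hx Hg HD cH i j Hi Hj.
  destruct (Nat.eq_dec i j) as [->|Hij]; auto.
  apply cond_eq; intros eps He.
  destruct (second_difference_estimate n O g D H x i j HO Hx Hi Hj Hij Hg HD (cH j i Hj Hi) (eps / 4))
    as [r1 [Hr1 E1]]; [lra|].
  destruct (second_difference_estimate n O g D H x j i HO Hx Hj Hi ltac:(auto) Hg HD (cH i j Hi Hj) (eps / 4))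
    as [r2 [Hr2 E2]]; [lra|].
  pose (h := Rmin r1 r2); assert (Hh : 0 < h) by (apply Rmin_pos; auto).
  specialize (E1 h Hh (Rmin_l _ _)); specialize (E2 h Hh (Rmin_r _ _)).
  rewrite (upd_comm x j i) in E2 by auto.
  set (a := g (upd (upd x i (x i + h)) j (x j + h))) in *.
  set (b := g (upd x i (x i + h))) in *; set (c := g (upd x j (x j + h))) in *.
  assert (Hhh : 0 < h * h) by (apply Rmult_lt_0_compat; auto).
  assert (E : Rabs ((H x i j - H x j i) * (h * h)) <= eps / 2 * (h * h)).
  { replace ((H x i j - H x j i) * (h * h)) with
      ((a - b - c + g x - H x j i * h * h) - (a - c - b + g x - H x i j * h * h)) by ring.
    eapply Rle_trans; [apply Rabs_triang|]; rewrite Rabs_Ropp; lra. }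
  rewrite Rabs_mult, (Rabs_right (h * h)) in E by lra.
  apply Rmult_le_reg_r in E; auto; lra.
Qed.

Lemma closure_incl n O x : is_open n O -> O x -> closure_n n O x.
Proof.
  intros HO Hx; split; [apply HO; auto|]; intros r Hr; exists x; rewrite distn_refl; auto.
Qed.

Lemma cyl_slice n O S g t : 0 <= t -> cont_on_cyl n S g -> (forall x, O x -> S x) ->
  cont_on n O (fun x => g x t).
Proof.
  intros Ht Hg HS x Hx eps He; destruct (Hg x t (HS x Hx) Ht eps He) as [d [Hd H]].
  exists d; split; auto; intros y Hy Hyx; apply H; auto.
  rewrite Rminus_diag, Rabs_R0; auto.
Qed.

Lemma cont_on_subset n (S S' : Rn -> Prop) g : (forall x, S x -> S' x) -> cont_on n S' g -> cont_on n S g.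
Proof.
  intros HS Hg x Hx eps He; destruct (Hg x (HS x Hx) eps He) as [d [Hd H]].
  exists d; split; auto.
Qed.

(** Derivatives of [u] are given for [t > 0] only, but the initial condition concerns time 0. The
    mean value estimate holds for small [t > 0] with a bound free of [t], and it survives the limit
    [t -> 0] by continuity of [g]. *)
Lemma has_partial_initial n O g D i x : is_open n O -> O x -> (i < n)%nat ->
  cont_on_cyl n (closure_n n O) g -> cont_on_cyl n (closure_n n O) D ->
  (forall y t, O y -> 0 < t -> has_partial (fun y => g y t) i y (D y t)) ->
  has_partial (fun y => g y 0) i x (D x 0).
Proof.
  intros HO Hx Hi cg cD Hp eps He.
  assert (Cx := closure_incl n O x HO Hx).
  assert (Rx : in_Rn n x) by (apply HO; auto).
  assert (Hn : 0 <= INR n) by apply pos_INR.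
  destruct (open_box n O x HO Hx) as [r [Hr HB]].
  destruct (cD x 0 Cx (Rle_refl 0) (eps / 2)) as [d [Hd HD]]; [lra|].
  pose (rho := Rmin r (d / (INR n + 1))).
  assert (Hrho : 0 < rho) by (apply Rmin_pos; auto; apply Rdiv_lt_0_compat; lra).
  exists (mkposreal _ Hrho); intros h Hh Hhr; simpl in Hhr.
  assert (b1 := Rmin_l r (d / (INR n + 1))); assert (b2 := Rmin_r r (d / (INR n + 1))).
  fold rho in b1, b2.
  assert (near : forall s, Rabs (s - x i) <= Rabs h -> O (upd x i s) /\ distn n (upd x i s) x < d).
  { intros s Hs.
    assert (box : forall k, (k < n)%nat -> Rabs (upd x i s k - x k) <= rho).
    { intros k Hk; destruct (Nat.eq_dec k i) as [->|Hki]; [rewrite upd_same; lra|].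
      rewrite upd_other, Rminus_diag, Rabs_R0 by auto; lra. }
    split.
    - apply HB; [apply in_Rn_upd; auto|]; intros k Hk; specialize (box k Hk); lra.
    - eapply Rle_lt_trans; [apply distn_le; [apply box|lra]|].
      apply Rle_lt_trans with (INR n * (d / (INR n + 1))); [apply Rmult_le_compat_l; auto|].
      apply Rmult_lt_reg_r with (INR n + 1); [lra|].
      replace (INR n * (d / (INR n + 1)) * (INR n + 1)) with (INR n * d) by (field; lra); nra. }
  destruct (near (x i + h)) as [Oy _].
  { replace (x i + h - x i) with h by ring; lra. }
  set (y := upd x i (x i + h)) in *.
  assert (Cy := closure_incl n O y HO Oy).
  assert (pos_t : forall t, 0 < t -> t < d ->
    Rabs (g y t - g x t - D x 0 * h) <= eps / 2 * Rabs h).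
  { intros t Ht Htd.
    assert (P := partial_increment (fun y => g y t) i (fun y => D y t) (D x 0) (eps / 2) x (x i + h)).
    replace (x i + h - x i) with h in P by ring; apply P.
    intros s Hs; destruct (near s Hs) as [Os Ds]; split; auto.
    apply Rlt_le, HD; auto; [apply closure_incl; auto|lra|].
    rewrite Rminus_0_r, Rabs_right; lra. }
  assert (lim : Rabs (g y 0 - g x 0 - D x 0 * h) <= eps / 2 * Rabs h).
  { apply le_epsilon; intros e He'.
    destruct (cg y 0 Cy (Rle_refl 0) (e / 2)) as [d1 [Hd1 H1]]; [lra|].
    destruct (cg x 0 Cx (Rle_refl 0) (e / 2)) as [d2 [Hd2 H2]]; [lra|].
    pose (t := Rmin d (Rmin d1 d2) / 2).
    assert (c1 := Rmin_l d (Rmin d1 d2)); assert (c2 := Rmin_r d (Rmin d1 d2)).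
    assert (c3 := Rmin_l d1 d2); assert (c4 := Rmin_r d1 d2).
    assert (Ht : 0 < Rmin d (Rmin d1 d2)) by (repeat apply Rmin_pos; auto).
    assert (Ht' : Rabs (t - 0) = t) by (rewrite Rminus_0_r, Rabs_right; unfold t; lra).
    specialize (H1 y t Cy ltac:(unfold t; lra) ltac:(rewrite distn_refl; auto) ltac:(rewrite Ht'; unfold t; lra)).
    specialize (H2 x t Cx ltac:(unfold t; lra) ltac:(rewrite distn_refl; auto) ltac:(rewrite Ht'; unfold t; lra)).
    specialize (pos_t t ltac:(unfold t; lra) ltac:(unfold t; lra)).
    replace (g y 0 - g x 0 - D x 0 * h) with
      ((g y t - g x t - D x 0 * h) + ((g x t - g x 0) - (g y t - g y 0))) by ring.
    eapply Rle_trans; [apply Rabs_triang|].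
    apply Rplus_le_compat; auto.
    eapply Rle_trans; [apply Rabs_triang|]; rewrite Rabs_Ropp; lra. }
  rewrite upd_id; fold y.
  replace ((g y 0 - g x 0) / h - D x 0) with ((g y 0 - g x 0 - D x 0 * h) / h) by (field; auto).
  assert (h0 := Rabs_pos_lt h Hh).
  unfold Rdiv at 1; rewrite Rabs_mult, Rabs_inv.
  apply Rmult_lt_reg_r with (Rabs h); auto.
  rewrite Rmult_assoc, Rinv_l, Rmult_1_r by lra.
  eapply Rle_lt_trans; [apply lim|]; nra.
Qed.

Lemma has_partial_unique n O g h i x a b : is_open n O -> O x -> (i < n)%nat ->
  (forall y, O y -> g y = h y) -> has_partial g i x a -> has_partial h i x b -> a = b.
Proof.
  intros HO Hx Hi E Ha Hb; destruct (open_box n O x HO Hx) as [r [Hr HB]].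
  apply (uniqueness_limite (fun s => h (upd x i s)) (x i)); auto.
  intros eps He; destruct (Ha eps He) as [d Hd].
  assert (Hm : 0 < Rmin r d) by (apply Rmin_pos; [auto|apply cond_pos]).
  assert (m1 := Rmin_l r d); assert (m2 := Rmin_r r d).
  exists (mkposreal _ Hm); intros s Hs Hsr; simpl in Hsr.
  assert (near : forall t, Rabs (t - x i) <= r -> O (upd x i t)).
  { intros t Ht; apply HB; [apply in_Rn_upd; auto; apply HO; auto|].
    intros k Hk; destruct (Nat.eq_dec k i) as [->|Hki]; [rewrite upd_same; auto|].
    rewrite upd_other, Rminus_diag, Rabs_R0 by auto; lra. }
  rewrite <- !E; [apply Hd; auto; lra| |].
  - rewrite upd_id; auto.
  - apply near; replace (x i + s - x i) with s by ring; lra.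
Qed.

(** * Extrema on compact cylinders *)

(** Coquelicot states the compactness of boxes for iterated pairs; below, the head of the tuple is
    the time. *)
Fixpoint to_Tn (n : nat) (x : Rn) : Compactness.Tn n R :=
  match n with O => tt | S n' => (x O, to_Tn n' (fun i => x (S i))) end.

Fixpoint of_Tn (n : nat) : Compactness.Tn n R -> Rn :=
  match n with
  | O => fun _ _ => 0
  | S n' => fun v i => match i with O => fst v | S j => of_Tn n' (snd v) j end
  end.

Lemma in_Rn_of_Tn n v : in_Rn n (of_Tn n v).
Proof.
  induction n as [|n IH]; intros i Hi; simpl; auto.
  destruct i as [|i]; [lia|apply IH; lia].
Qed.

Lemma bounded_to_Tn n a b x : (forall i, (i < n)%nat -> a i <= x i <= b i) ->
  Compactness.bounded_n n (to_Tn n a) (to_Tn n b) (to_Tn n x).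
Proof.
  revert a b x; induction n as [|n IH]; intros a b x H; simpl; auto.
  split; [apply H; lia|apply IH; intros i Hi; apply H; lia].
Qed.

Lemma close_to_Tn n d x v : Compactness.close_n n d (to_Tn n x) v ->
  forall i, (i < n)%nat -> Rabs (x i - of_Tn n v i) < d.
Proof.
  revert x v; induction n as [|n IH]; intros x v H i Hi; [lia|].
  destruct v as [v1 v2]; destruct H as [H1 H2]; destruct i as [|i]; simpl; auto.
  apply (IH (fun i => x (S i))); auto; lia.
Qed.

Lemma list_argmin {A} (F : A -> R) (l : list A) (a : A) : In a l ->
  exists m, In m l /\ forall b, In b l -> F m <= F b.
Proof.
  revert a; induction l as [|c l IH]; intros a Ha; [destruct Ha|].
  destruct l as [|d l].
  - exists c; split; [left; auto|]; intros b [->|[]]; lra.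
  - destruct (IH d ltac:(left; auto)) as [m [Hm1 Hm2]].
    destruct (Rle_dec (F c) (F m)) as [Hc|Hc].
    + exists c; split; [left; auto|]; intros b [->|Hb]; [lra|].
      apply Rle_trans with (F m); auto.
    + exists m; split; [right; auto|]; intros b [->|Hb]; [lra|auto].
Qed.

Lemma closure_coord_bound n O M x i : (forall y, O y -> normn n y <= M) -> closure_n n O x ->
  (i < n)%nat -> Rabs (x i) <= M + 1.
Proof.
  intros HM [_ Hx] Hi; destruct (Hx 1 Rlt_0_1) as [y [Hy Hd]].
  assert (H1 := normn_coord n y i Hi); assert (H2 := HM y Hy).
  assert (H3 := distn_coord n x y i Hi).
  replace (x i) with (y i - (y i - x i)) by ring.
  eapply Rle_trans; [apply Rabs_triang|]; rewrite Rabs_Ropp; lra.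
Qed.

Lemma closure_closed n O y : in_Rn n y ->
  (forall d, 0 < d -> exists z, closure_n n O z /\ forall i, (i < n)%nat -> Rabs (z i - y i) < d) ->
  closure_n n O y.
Proof.
  intros Hy H; split; auto; intros r Hr.
  assert (Hn : 0 <= INR n) by apply pos_INR.
  pose (d := r / (2 * (INR n + 1))).
  assert (Hd : 0 < d) by (apply Rdiv_lt_0_compat; lra).
  destruct (H d Hd) as [z [[_ Hz] Hzy]]; destruct (Hz d Hd) as [w [Hw Hwz]].
  exists w; split; auto; eapply Rle_lt_trans; [apply (distn_le n y w (2 * d))|].
  - intros i Hi; assert (H1 := distn_coord n z w i Hi); specialize (Hzy i Hi).
    replace (w i - y i) with ((w i - z i) + (z i - y i)) by ring.
    eapply Rle_trans; [apply Rabs_triang|]; lra.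
  - lra.
  - apply Rmult_lt_reg_r with (INR n + 1); [lra|].
    replace (INR n * (2 * d) * (INR n + 1)) with (INR n * r) by (unfold d; field; lra); nra.
Qed.

(* Without a minimum, every point has a neighbourhood on which [g] exceeds some value [g k]; by
   compactness finitely many of these values suffice, and the least of them is not exceeded. *)
Lemma cylinder_min n O g a b : is_bounded n O -> (exists x, closure_n n O x) ->
  0 <= a -> a <= b -> cont_on_cyl n (closure_n n O) g ->
  exists x t, closure_n n O x /\ a <= t <= b /\
    forall y s, closure_n n O y -> a <= s <= b -> g x t <= g y s.
Proof.
  intros [M HM] [x0 Hx0] Ha Hab Hg; apply NNPP; intros Hno.
  assert (nomin : forall x t, closure_n n O x -> a <= t <= b ->
    exists k : Rn * R, closure_n n O (fst k) /\ a <= snd k <= b /\ g (fst k) (snd k) < g x t).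
  { intros x t Hx Ht; apply NNPP; intros Hk; apply Hno; exists x, t; repeat split; try apply Ht; try apply Hx.
    intros y s Hy Hs; apply Rnot_lt_le; intros Hlt; apply Hk; exists (y, s); auto. }
  assert (Hn : 0 <= INR n) by apply pos_INR.
  assert (gauge : forall T : Compactness.Tn (S n) R, exists p : posreal * (Rn * R),
    closure_n n O (fst (snd p)) /\ a <= snd (snd p) <= b /\
    forall y s, closure_n n O y -> a <= s <= b -> Rabs (s - fst T) < fst p ->
      (forall i, (i < n)%nat -> Rabs (y i - of_Tn n (snd T) i) < fst p) ->
      g (fst (snd p)) (snd (snd p)) < g y s).
  { intros [t v]; simpl fst; simpl snd; set (x := of_Tn n v).
    destruct (classic (exists d, 0 < d /\ forall y s, closure_n n O y -> a <= s <= b ->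
      Rabs (s - t) < d -> (forall i, (i < n)%nat -> Rabs (y i - x i) < d) -> False)) as [[d [Hd H]]|H].
    (* Away from the cylinder the neighbourhood is chosen to miss it, and [(x0, a)] is a mere
       placeholder. *)
    - exists (mkposreal d Hd, (x0, a)); simpl; repeat split; try apply Hx0; try lra.
      intros y s Hy Hs H1 H2; destruct (H y s Hy Hs H1 H2).
    - assert (near : forall d, 0 < d -> exists y s, closure_n n O y /\ a <= s <= b /\
        Rabs (s - t) < d /\ forall i, (i < n)%nat -> Rabs (y i - x i) < d).
      { intros d Hd; apply NNPP; intros H1; apply H; exists d; split; auto.
        intros y s Hy Hs H2 H3; apply H1; exists y, s; auto. }
      assert (Hx : closure_n n O x).
      { apply closure_closed; [apply in_Rn_of_Tn|]; intros d Hd.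
        destruct (near d Hd) as [y [s [Hy [_ [_ H1]]]]]; exists y; auto. }
      assert (Ht : a <= t <= b).
      { split; apply le_epsilon; intros e He; destruct (near e He) as [y [s [_ [Hs [H1 _]]]]];
          apply Rabs_def2 in H1; lra. }
      destruct (nomin x t Hx Ht) as [k [Hk1 [Hk2 Hk3]]].
      destruct (Hg x t Hx ltac:(lra) (g x t - g (fst k) (snd k))) as [d [Hd H1]]; [lra|].
      assert (Hd' : 0 < d / (INR n + 1)) by (apply Rdiv_lt_0_compat; lra).
      assert (Hdd : d / (INR n + 1) <= d).
      { apply Rmult_le_reg_r with (INR n + 1); [lra|].
        replace (d / (INR n + 1) * (INR n + 1)) with d by (field; lra); nra. }
      exists (mkposreal _ Hd', k); simpl; repeat split; try apply Hk1; try apply Hk2.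
      intros y s Hy Hs H2 H3; assert (H4 : Rabs (g y s - g x t) < g x t - g (fst k) (snd k)).
      { apply H1; auto; [lra| |lra].
        eapply Rle_lt_trans; [apply (distn_le n x y (d / (INR n + 1)))|].
        - intros; apply Rlt_le; auto.
        - lra.
        - apply Rmult_lt_reg_r with (INR n + 1); [lra|].
          replace (INR n * (d / (INR n + 1)) * (INR n + 1)) with (INR n * d) by (field; lra); nra. }
      apply Rabs_def2 in H4; lra. }
  destruct (functional_choice _ gauge) as [p Hp].
  (* The finite subcover is available under a double negation, which is enough because the goal is
     [False]. *)
  apply (Compactness.compactness_list (S n)
    (to_Tn (S n) (fun i => match i with O => a | S _ => - (M + 1) end))
    (to_Tn (S n) (fun i => match i with O => b | S _ => M + 1 end)) (fun T => fst (p T))).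
  intros [l Hl].
  assert (cover : forall y s, closure_n n O y -> a <= s <= b ->
    exists T, In T l /\ g (fst (snd (p T))) (snd (snd (p T))) < g y s).
  { intros y s Hy Hs; pose (z := fun i => match i with O => s | S j => y j end).
    destruct (Hl (to_Tn (S n) z)) as [T [HT1 [_ HT2]]].
    - apply bounded_to_Tn; intros [|i] Hi; simpl; auto.
      assert (Hyj := closure_coord_bound n O M y i HM Hy ltac:(lia)).
      assert (b1 := Rle_abs (y i)); assert (b2 := Rle_abs (- y i)); rewrite Rabs_Ropp in b2; lra.
    - assert (Hc := close_to_Tn (S n) _ z T HT2).
      exists T; split; auto; apply Hp; auto.
      + apply (Hc 0%nat); lia.
      + intros i Hi; apply (Hc (S i)); lia. }
  destruct (cover x0 a Hx0 ltac:(lra)) as [T0 [HT0 _]].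
  destruct (list_argmin (fun T => g (fst (snd (p T))) (snd (snd (p T)))) l T0 HT0) as [m [Hm1 Hm2]].
  destruct (Hp m) as [Hm3 [Hm4 _]].
  destruct (cover _ _ Hm3 Hm4) as [T1 [HT1 HT2]].
  specialize (Hm2 T1 HT1); lra.
Qed.

(** The case [a = b] is allowed and serves for single time slices and for functions of [x] alone. *)
Lemma cylinder_bounded n O g a b : is_bounded n O ->
  0 <= a -> a <= b -> cont_on_cyl n (closure_n n O) g ->
  exists C, forall y s, closure_n n O y -> a <= s <= b -> Rabs (g y s) <= C.
Proof.
  intros HB Ha Hab Hg; destruct (classic (exists x, closure_n n O x)) as [Hne|Hne].
  - destruct (cylinder_min n O g a b HB Hne Ha Hab Hg) as [x [t [_ [_ H1]]]].
    destruct (cylinder_min n O (fun x t => -1 * g x t) a b HB Hne Ha Hab) as [y [s [_ [_ H2]]]].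
    { apply cont_on_cyl_mult; auto; apply cont_on_cyl_const. }
    exists (Rabs (g x t) + Rabs (g y s)); intros z r Hz Hr.
    specialize (H1 z r Hz Hr); specialize (H2 z r Hz Hr).
    assert (a1 := Rabs_pos (g x t)); assert (a2 := Rabs_pos (g y s)).
    assert (b1 := Rle_abs (- g x t)); assert (b2 := Rle_abs (g y s)); rewrite Rabs_Ropp in b1.
    apply Rabs_le; lra.
  - exists 0; intros y s Hy; destruct Hne; exists y; auto.
Qed.

Lemma cont_on_cyl_static n S g : cont_on n S g -> cont_on_cyl n S (fun x _ => g x).
Proof.
  intros H x t Hx _ eps He; destruct (H x Hx eps He) as [d [Hd H1]].
  exists d; split; auto.
Qed.

(** * Admissibility of the evolution *)

Lemma cont_on_cyl_block n D (a : Rn -> R -> R) (M : Rn -> R -> Mat) :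
  cont_on_cyl n D a ->
  (forall i j, (i < n)%nat -> (j < n)%nat -> cont_on_cyl n D (fun x t => M x t i j)) ->
  forall i j, (i < S n)%nat -> (j < S n)%nat -> cont_on_cyl n D (fun x t => block (a x t) (M x t) i j).
Proof.
  intros Ha HM [|i] [|j] Hi Hj; simpl; auto; try apply cont_on_cyl_const.
  apply HM; lia.
Qed.

Lemma k_positive_open n D k (M : Rn -> R -> Mat) x t :
  (forall i j, (i < n)%nat -> (j < n)%nat -> cont_on_cyl n D (fun x t => M x t i j)) ->
  D x -> 0 <= t -> k_positive n k (M x t) ->
  exists d, 0 < d /\ forall y s, D y -> 0 <= s -> distn n y x < d -> Rabs (s - t) < d ->
    k_positive n k (M y s).
Proof.
  intros HM Hx Ht; induction k as [|k IH]; intros HK.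
  - exists 1; split; [lra|]; intros y s _ _ _ _ p Hp1 Hp; lia.
  - destruct IH as [d1 [Hd1 H1]]; [intros p Hp1 Hp; apply HK; lia|].
    assert (HT := HK (S k) ltac:(lia) ltac:(lia)).
    destruct (cont_on_cyl_Tp n D n (S k) M HM x t Hx Ht _ HT) as [d2 [Hd2 H2]].
    exists (Rmin d1 d2); split; [apply Rmin_pos; auto|].
    assert (m1 := Rmin_l d1 d2); assert (m2 := Rmin_r d1 d2).
    intros y s Hy Hs Hyx Hst p Hp1 Hp.
    destruct (Nat.eq_dec p (S k)) as [->|Hpk].
    + specialize (H2 y s Hy Hs ltac:(lra) ltac:(lra)); apply Rabs_def2 in H2; lra.
    + apply (H1 y s Hy Hs); [lra|lra|lia|lia].
Qed.

Section Admissibility.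

Variables (n m : nat) (Omega : Rn -> Prop) (Hu : Rn -> R -> Mat) (Ut : Rn -> R -> R) (nu : R).
Hypothesis HO : is_open n Omega.
Hypothesis m_pos : (1 <= m)%nat.
Hypothesis m_le : (m <= n)%nat.
Hypothesis nu_pos : 0 < nu.
Hypothesis cHu : forall i j, (i < n)%nat -> (j < n)%nat ->
  cont_on_cyl n (closure_n n Omega) (fun x t => Hu x t i j).
Hypothesis cUt : cont_on_cyl n (closure_n n Omega) Ut.
Hypothesis symHu : forall x t, Omega x -> 0 < t -> symmetric n (Hu x t).
Hypothesis Em_ge : forall x t, Omega x -> 0 < t -> nu <= Em n m (Ut x t) (Hu x t).

(* On the admissible set [Tp_lower_bound] keeps every [T_p] of [block (- Ut) Hu] away from zero. *)
Lemma admissible_closed x t : Omega x -> 0 < t ->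
  (forall d, 0 < d -> exists y s, Omega y /\ 0 < s /\ distn n y x < d /\ Rabs (s - t) < d /\
     k_positive n (m - 1) (Hu y s)) ->
  k_positive n (m - 1) (Hu x t).
Proof.
  intros Hx Ht H; pose (Z := fun x t => block (- Ut x t) (Hu x t)).
  assert (cZ : forall p, cont_on_cyl n (closure_n n Omega) (fun x t => Tp (S n) p (Z x t))).
  { intros p; apply cont_on_cyl_Tp; unfold Z.
    apply (cont_on_cyl_block n _ (fun x t => - Ut x t)); auto.
    intros y s Hy Hs e He; destruct (cUt y s Hy Hs e He) as [d [Hd Hc]].
    exists d; split; auto; intros z r Hz Hr H1 H2.
    replace (- Ut z r - - Ut y s) with (- (Ut z r - Ut y s)) by ring; rewrite Rabs_Ropp; auto. }
  assert (Cx := closure_incl n Omega x HO Hx).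
  (* By continuity with tolerance 1 this bounds [T_(m-1) (Z)] at all nearby points as well, so the
     lower bounds obtained there do not degenerate. *)
  pose (B := Rabs (Tp (S n) (m - 1) (Z x t)) + 1).
  assert (HB : 0 < B) by (unfold B; assert (a := Rabs_pos (Tp (S n) (m - 1) (Z x t))); lra).
  assert (low : forall p, (p <= m)%nat -> (nu / B) ^ p <= Tp (S n) p (Z x t)).
  { intros p Hp; apply le_epsilon; intros e He.
    destruct (cZ p x t Cx ltac:(lra) e He) as [d1 [Hd1 H1]].
    destruct (cZ (m - 1)%nat x t Cx ltac:(lra) 1 Rlt_0_1) as [d2 [Hd2 H2]].
    destruct (H (Rmin d1 d2)) as [y [s [Hy [Hs [Hyx [Hst HK]]]]]]; [apply Rmin_pos; auto|].
    assert (m1 := Rmin_l d1 d2); assert (m2 := Rmin_r d1 d2).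
    assert (Cy := closure_incl n Omega y HO Hy).
    specialize (H1 y s Cy ltac:(lra) ltac:(lra) ltac:(lra)).
    specialize (H2 y s Cy ltac:(lra) ltac:(lra) ltac:(lra)).
    assert (HT := Em_ge y s Hy Hs); rewrite Em_block in HT by auto.
    assert (L : (nu / B) ^ p <= Tp (S n) p (Z y s)).
    { apply (Tp_lower_bound (S n) m); auto.
      - apply symmetric_block; auto.
      - apply k_positive_block; auto; lra.
      - apply Rabs_def2 in H2; unfold B.
        assert (a := Rle_abs (Tp (S n) (m - 1) (Z x t))); lra. }
    apply Rabs_def2 in H1; lra. }
  apply (k_positive_unblock n m (- Ut x t)); auto.
  intros p Hp1 Hp; apply Rlt_le_trans with ((nu / B) ^ p); auto.
  apply pow_lt, Rdiv_lt_0_compat; auto.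
Qed.

(** Continuation in time at the fixed point [x0]: the supremum [c] of the times up to which
    admissibility holds is itself admissible by [admissible_closed], or by the initial condition if
    [c = 0], and by openness admissibility extends beyond [c < t1]. *)
Lemma admissible_forward x0 : Omega x0 -> k_positive n (m - 1) (Hu x0 0) ->
  forall t, 0 <= t -> k_positive n (m - 1) (Hu x0 t).
Proof.
  intros Hx0 H0 t1 Ht1; apply NNPP; intros Hno.
  assert (C0 := closure_incl n Omega x0 HO Hx0).
  pose (E := fun s => 0 <= s <= t1 /\ forall r, 0 <= r <= s -> k_positive n (m - 1) (Hu x0 r)).
  assert (E0 : E 0).
  { split; [lra|]; intros r Hr; replace r with 0 by lra; auto. }
  destruct (completeness E) as [c [Hc1 Hc2]].
  { exists t1; intros s [Hs _]; lra. }
  { exists 0; auto. }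
  assert (c0 : 0 <= c) by (apply Hc1; auto).
  assert (ct : c <= t1) by (apply Hc2; intros s [Hs _]; lra).
  assert (below : forall r, 0 <= r < c -> k_positive n (m - 1) (Hu x0 r)).
  { intros r Hr; apply NNPP; intros Hr'.
    assert (c <= r); [|lra]; apply Hc2; intros s [Hs1 Hs2].
    apply Rnot_lt_le; intros Hrs; apply Hr', Hs2; lra. }
  assert (at_c : k_positive n (m - 1) (Hu x0 c)).
  { destruct (Rle_lt_or_eq_dec 0 c c0) as [Hc|<-]; auto.
    apply admissible_closed; auto; intros d Hd.
    assert (m1 := Rmin_l c d); assert (m2 := Rmin_r c d).
    assert (Hm : 0 < Rmin c d) by (apply Rmin_pos; auto).
    exists x0, (c - Rmin c d / 2); repeat split; auto; try lra.
    - rewrite distn_refl; auto.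
    - rewrite Rabs_left; lra.
    - apply below; lra. }
  destruct (Rle_lt_or_eq_dec c t1 ct) as [Hlt|Heq]; [|subst; auto].
  destruct (k_positive_open n _ (m - 1) Hu x0 c cHu C0 c0 at_c) as [d [Hd HK]].
  assert (m1 := Rmin_l (t1 - c) d); assert (m2 := Rmin_r (t1 - c) d).
  assert (Hm : 0 < Rmin (t1 - c) d) by (apply Rmin_pos; lra).
  assert (E (c + Rmin (t1 - c) d / 2)).
  { split; [lra|]; intros r Hr.
    destruct (Rlt_le_dec r c) as [Hrc|Hrc]; [apply below; lra|].
    apply HK; auto; [lra|rewrite distn_refl; auto|rewrite Rabs_right; lra]. }
  assert (c + Rmin (t1 - c) d / 2 <= c) by (apply Hc1; auto); lra.
Qed.

(** In the slice at time [t] both the admissible set and its complement in [Omega] are open, and the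
    former contains [x0] by [admissible_forward]; connectedness does the rest. *)
Lemma admissible_everywhere x0 : connected n Omega -> Omega x0 ->
  k_positive n (m - 1) (Hu x0 0) ->
  forall x t, Omega x -> 0 < t -> k_positive n (m - 1) (Hu x t).
Proof.
  intros Hconn Hx0 H0 x t Hx Ht.
  pose (A := fun y => Omega y /\ k_positive n (m - 1) (Hu y t)).
  pose (B := fun y => Omega y /\ ~ k_positive n (m - 1) (Hu y t)).
  assert (near : forall y, Omega y -> forall d, 0 < d -> exists r, 0 < r /\ r <= d /\
     forall z, in_Rn n z -> distn n z y < r -> Omega z).
  { intros y Hy d Hd; destruct HO as [_ HO2]; destruct (HO2 y Hy) as [r [Hr HB]].
    assert (m1 := Rmin_l r d); assert (m2 := Rmin_r r d).
    exists (Rmin r d); repeat split; [apply Rmin_pos; auto|auto|].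
    intros z Hz Hzy; apply HB; auto; lra. }
  assert (oA : is_open n A).
  { split; [intros y [Hy _]; apply HO; auto|]; intros y [Hy HK].
    destruct (k_positive_open n _ (m - 1) Hu y t cHu (closure_incl n Omega y HO Hy) ltac:(lra) HK)
      as [d [Hd HKd]].
    destruct (near y Hy d Hd) as [r [Hr [Hrd HB]]]; exists r; split; auto.
    intros z Hz Hzy; assert (Oz := HB z Hz Hzy); split; auto.
    apply HKd; [apply closure_incl; auto|lra|lra|rewrite Rminus_diag, Rabs_R0; auto]. }
  assert (oB : is_open n B).
  { split; [intros y [Hy _]; apply HO; auto|]; intros y [Hy HK].
    assert (Hd : exists d, 0 < d /\ forall z, Omega z -> distn n z y < d -> ~ k_positive n (m - 1) (Hu z t)).
    { apply NNPP; intros Hno; apply HK, admissible_closed; auto.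
      intros d Hd; apply NNPP; intros Hno2; apply Hno; exists d; split; auto.
      intros z Hz Hzy HKz; apply Hno2; exists z, t; repeat split; auto.
      rewrite Rminus_diag, Rabs_R0; auto. }
    destruct Hd as [d [Hd HKd]].
    destruct (near y Hy d Hd) as [r [Hr [Hrd HB]]]; exists r; split; auto.
    intros z Hz Hzy; assert (Oz := HB z Hz Hzy); split; auto.
    apply HKd; auto; lra. }
  destruct (Hconn A B oA oB) as [HA|HB].
  - intros y Hy; destruct (classic (k_positive n (m - 1) (Hu y t))); [left|right]; split; auto.
  - intros y _ [_ H1] [_ H2]; auto.
  - apply HA; auto.
  - destruct (HB x0 Hx0) as [_ H1]; destruct H1.
    apply (admissible_forward x0 Hx0 H0); lra.
Qed.

End Admissibility.

(** * Barriers *)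

(** The minimum over a cylinder may be attained at its final time, where only earlier times can be
    compared; hence an inequality rather than a vanishing derivative. *)
Lemma left_min_derivative h T t l : T < t -> derivable_pt_lim h t l ->
  (forall s, T <= s <= t -> h t <= h s) -> l <= 0.
Proof.
  intros HT Hh Hmin; apply Rnot_lt_le; intros Hl.
  destruct (Hh (l / 2)) as [d Hd]; [lra|].
  assert (m1 := Rmin_l (t - T) d); assert (m2 := Rmin_r (t - T) d).
  assert (Hm : 0 < Rmin (t - T) d) by (apply Rmin_pos; [lra|apply cond_pos]).
  set (r := Rmin (t - T) d / 2) in *.
  assert (Hr : 0 < r) by (unfold r; lra).
  specialize (Hd (- r) ltac:(lra) ltac:(rewrite Rabs_Ropp, Rabs_right; unfold r in *; lra)).
  apply Rabs_def2 in Hd.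
  specialize (Hmin (t + - r) ltac:(unfold r in *; lra)).
  assert (H : (h (t + - r) - h t) / - r * r <= 0).
  { replace ((h (t + - r) - h t) / - r * r) with (- (h (t + - r) - h t)) by (field; lra); lra. }
  nra.
Qed.

Lemma cont_on_cyl_time n D h : (forall t, continuity_pt h t) -> cont_on_cyl n D (fun _ t => h t).
Proof.
  intros Hh x t _ _ e He; destruct (Hh t e He) as [d [Hd H]].
  exists d; split; auto; intros y s _ _ _ Hs.
  destruct (Req_dec s t) as [->|Hn]; [rewrite Rminus_diag, Rabs_R0; auto|].
  apply H; split; [split; [exact I|auto]|exact Hs].
Qed.

Lemma cont_on_coord n D i : (i < n)%nat -> cont_on n D (fun x => x i).
Proof.
  intros Hi x Hx e He; exists e; split; auto; intros y Hy Hyx.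
  eapply Rle_lt_trans; [apply distn_coord; eauto|auto].
Qed.

Definition sqnorm (n : nat) (x : Rn) : R := sumR n (fun i => x i * x i).

Lemma cont_on_cyl_sqnorm n D : cont_on_cyl n D (fun x _ => sqnorm n x).
Proof.
  unfold sqnorm; assert (H : forall k, (k <= n)%nat ->
    cont_on_cyl n D (fun x _ => sumR k (fun i => x i * x i))).
  { induction k as [|k IH]; intros Hk; simpl; [apply cont_on_cyl_const|].
    assert (c := cont_on_cyl_static n D _ (cont_on_coord n D k Hk)).
    apply (cont_on_cyl_plus n D (fun x _ => sumR k (fun i => x i * x i))); [apply IH; lia|].
    apply (cont_on_cyl_mult n D (fun x _ => x k)); auto. }
  apply H; auto.
Qed.

Lemma sqnorm_upd n x i s : (i < n)%nat -> sqnorm n (upd x i s) = sqnorm n x + (s * s - x i * x i).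
Proof.
  intros Hi; unfold sqnorm.
  rewrite (sumR_ext n _ (fun k => x k * x k + (upd x i s k * upd x i s k - x k * x k))) by (intros; ring).
  rewrite sumR_plus, (sumR_single n i (fun k => upd x i s k * upd x i s k - x k * x k)); auto.
  - rewrite upd_same; auto.
  - intros k _ Hk; rewrite upd_other by auto; ring.
Qed.

Lemma has_partial_sqnorm n i x : (i < n)%nat -> has_partial (sqnorm n) i x (2 * x i).
Proof.
  intros Hi e He; exists (mkposreal e He); intros h Hh Hhe; simpl in Hhe.
  rewrite !sqnorm_upd by auto.
  replace ((sqnorm n x + ((x i + h) * (x i + h) - x i * x i) - (sqnorm n x + (x i * x i - x i * x i))) / h - 2 * x i)
    with h by (field; auto); auto.
Qed.

Definition kronecker (i j : nat) : R := if Nat.eqb i j then 1 else 0.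

Lemma has_partial_coord i j x : has_partial (fun y => y j) i x (kronecker i j).
Proof.
  intros e He; exists (mkposreal e He); intros h Hh _; unfold kronecker.
  destruct (Nat.eqb_spec i j) as [->|Hij].
  - rewrite !upd_same; replace ((x j + h - x j) / h - 1) with 0 by (field; auto); rewrite Rabs_R0; auto.
  - rewrite !upd_other by auto; replace ((x j - x j) / h - 0) with 0 by (field; auto); rewrite Rabs_R0; auto.
Qed.

Lemma has_partial_plus g h i x a b : has_partial g i x a -> has_partial h i x b ->
  has_partial (fun y => g y + h y) i x (a + b).
Proof. intros Ha Hb; apply (derivable_pt_lim_plus (fun s => g (upd x i s)) (fun s => h (upd x i s))); auto. Qed.

Lemma has_partial_scal g i x c a : has_partial g i x a -> has_partial (fun y => c * g y) i x (c * a).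
Proof. intros Ha; apply (derivable_pt_lim_scal (fun s => g (upd x i s))); auto. Qed.

Lemma has_partial_const c i x : has_partial (fun _ => c) i x 0.
Proof. apply derivable_pt_lim_const. Qed.

Lemma derivable_pt_lim_barrier C lam T t :
  derivable_pt_lim (fun t => C * exp (- lam * (t - T))) t (C * (exp (- lam * (t - T)) * (- lam * 1))).
Proof.
  apply (derivable_pt_lim_scal (fun t => exp (- lam * (t - T)))).
  apply (derivable_pt_lim_comp (fun t => - lam * (t - T)) exp); [|apply derivable_pt_lim_exp].
  apply (derivable_pt_lim_scal (fun t => t - T)).
  replace 1 with (1 - 0) by ring.
  apply (derivable_pt_lim_minus id (fun _ => T)); [apply derivable_pt_lim_id|apply derivable_pt_lim_const].
Qed.

(* [sg = 1] compares [u] with the lower barrier, [sg = -1] with the upper one. *)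
Lemma touching_point n Omega u Hu Ut U HU sg e R2 C lam T x1 t1 :
  is_open n Omega -> is_bounded n Omega ->
  C21_bar n Omega u Hu Ut -> C2_on n Omega (closure_n n Omega) U HU ->
  let w := fun x t => sg * (u x t + -1 * U x) + (e * (R2 + -1 * sqnorm n x) + C * exp (- lam * (t - T))) in
  0 <= T -> T <= t1 -> closure_n n Omega x1 -> w x1 t1 < 0 ->
  (forall x, closure_n n Omega x -> 0 <= w x T) ->
  (forall x t, boundary_n n Omega x -> T <= t -> 0 <= w x t) ->
  exists x t, Omega x /\ T < t /\
    sg * Ut x t <= C * lam * exp (- lam * (t - T)) /\
    symmetric n (Hu x t) /\ symmetric n (HU x) /\
    psd n (fun i j => sg * (Hu x t i j - HU x i j) - 2 * e * kronecker i j).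
Proof.
  intros HO HB [Du [Du1 [Du2 [Du3 [cu [cDu [cHu cUt]]]]]]] [DU [DU1 [DU2 [cU [cDU cHU]]]]] w
    HT Ht1 Hx1 Hw1 HwT Hwb.
  assert (cw : cont_on_cyl n (closure_n n Omega) w).
  { unfold w; apply (cont_on_cyl_plus n _ (fun x t => sg * (u x t + -1 * U x))).
    - apply (cont_on_cyl_mult n _ (fun _ _ => sg)); [apply cont_on_cyl_const|].
      apply (cont_on_cyl_plus n _ u); auto.
      apply (cont_on_cyl_mult n _ (fun _ _ => -1) (fun x _ => U x)); [apply cont_on_cyl_const|].
      apply cont_on_cyl_static; auto.
    - apply (cont_on_cyl_plus n _ (fun x t => e * (R2 + -1 * sqnorm n x))).
      + apply (cont_on_cyl_mult n _ (fun _ _ => e) (fun x _ => R2 + -1 * sqnorm n x)); [apply cont_on_cyl_const|].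
        apply (cont_on_cyl_plus n _ (fun _ _ => R2) (fun x _ => -1 * sqnorm n x)); [apply cont_on_cyl_const|].
        apply (cont_on_cyl_mult n _ (fun _ _ => -1) (fun x _ => sqnorm n x)); [apply cont_on_cyl_const|].
        apply cont_on_cyl_sqnorm.
      + apply (cont_on_cyl_time n _ (fun t => C * exp (- lam * (t - T)))); intros t.
        apply derivable_continuous_pt; eexists; apply derivable_pt_lim_barrier. }
  destruct (cylinder_min n Omega w T t1 HB ltac:(eauto) HT Ht1 cw) as [x [t [Hx [Ht Hmin]]]].
  assert (Hneg : w x t < 0) by (specialize (Hmin x1 t1 Hx1 ltac:(lra)); lra).
  assert (HtT : T < t).
  { destruct (Rle_lt_or_eq_dec T t (proj1 Ht)) as [|<-]; auto.
    specialize (HwT x Hx); lra. }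
  assert (Ox : Omega x).
  { apply NNPP; intros Hn; assert (Hb : boundary_n n Omega x) by (split; auto).
    specialize (Hwb x t Hb ltac:(lra)); lra. }
  assert (HCl : forall y, Omega y -> closure_n n Omega y) by (intros; apply closure_incl; auto).
  assert (slice : forall g, cont_on_cyl n (closure_n n Omega) g -> cont_on n Omega (fun y => g y t)).
  { intros g Hg; apply (cyl_slice n Omega (closure_n n Omega)); auto; lra. }
  assert (sub : forall g, cont_on n (closure_n n Omega) g -> cont_on n Omega g).
  { intros g Hg; apply (cont_on_subset n _ (closure_n n Omega)); auto. }
  assert (symH : symmetric n (Hu x t)).
  { apply (hessian_symmetric n Omega (fun y => u y t) (fun i y => Du i y t) (fun y => Hu y t)); auto.
    - intros; apply Du1; auto; lra.
    - intros; apply Du2; auto; lra.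
    - intros i j Hi Hj; apply (slice (fun y t => Hu y t i j)); auto. }
  assert (symHU : symmetric n (HU x)).
  { apply (hessian_symmetric n Omega U DU HU); auto. }
  exists x, t; repeat split; auto.
  - assert (Hd : sg * Ut x t + C * (exp (- lam * (t - T)) * (- lam * 1)) <= 0); [|lra].
    apply (left_min_derivative (fun s => w x s) T t); auto.
    + unfold w; replace (sg * Ut x t) with (sg * (Ut x t + 0)) by ring.
      apply (derivable_pt_lim_plus (fun s => sg * (u x s + -1 * U x))).
      * apply (derivable_pt_lim_scal (fun s => u x s + -1 * U x)).
        apply (derivable_pt_lim_plus (fun s => u x s)); [apply Du3; auto; lra|apply derivable_pt_lim_const].
      * replace (C * (exp (- lam * (t - T)) * (- lam * 1))) with (0 + C * (exp (- lam * (t - T)) * (- lam * 1))) by ring.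
        apply (derivable_pt_lim_plus (fun _ => e * (R2 + -1 * sqnorm n x))); [apply derivable_pt_lim_const|].
        apply derivable_pt_lim_barrier.
    + intros s Hs; apply Hmin; auto; lra.
  - apply (hessian_psd_at_min n Omega (fun y => w y t)
      (fun i y => sg * (Du i y t + -1 * DU i y) + -2 * e * y i)
      (fun y i j => sg * (Hu y t i j - HU y i j) - 2 * e * kronecker i j)); auto.
    + intros y i Oy Hi; unfold w.
      replace (sg * (Du i y t + -1 * DU i y) + -2 * e * y i) with
        (sg * (Du i y t + -1 * DU i y) + (e * (0 + -1 * (2 * y i)) + 0)) by ring.
      apply (has_partial_plus (fun y => sg * (u y t + -1 * U y))).
      * apply has_partial_scal, has_partial_plus; [apply Du1; auto; lra|].
        apply has_partial_scal; auto.
      * apply (has_partial_plus (fun y => e * (R2 + -1 * sqnorm n y))); [|apply has_partial_const].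
        apply (has_partial_scal (fun y => R2 + -1 * sqnorm n y)).
        apply (has_partial_plus (fun _ => R2)); [apply has_partial_const|].
        apply has_partial_scal, has_partial_sqnorm; auto.
    + intros y i j Oy Hi Hj.
      replace (sg * (Hu y t i j - HU y i j) - 2 * e * kronecker i j) with
        (sg * (Hu y t i j + -1 * HU y i j) + -2 * e * kronecker i j) by ring.
      apply (has_partial_plus (fun y => sg * (Du j y t + -1 * DU j y))).
      * apply (has_partial_scal (fun y => Du j y t + -1 * DU j y)).
        apply (has_partial_plus (fun y => Du j y t)); [apply Du2; auto; lra|].
        apply has_partial_scal; auto.
      * apply (has_partial_scal (fun y => y j)), has_partial_coord.
    + intros i Hi; apply (slice (fun y s => sg * (Du i y s + -1 * DU i y) + -2 * e * y i)).
      apply (cont_on_cyl_plus n _ (fun y s => sg * (Du i y s + -1 * DU i y)) (fun y _ => -2 * e * y i)).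
      * apply (cont_on_cyl_mult n _ (fun _ _ => sg)); [apply cont_on_cyl_const|].
        apply (cont_on_cyl_plus n _ (Du i)); auto.
        apply (cont_on_cyl_mult n _ (fun _ _ => -1) (fun x _ => DU i x)); [apply cont_on_cyl_const|].
        apply cont_on_cyl_static; auto.
      * apply (cont_on_cyl_mult n _ (fun _ _ => -2 * e) (fun x _ => x i)); [apply cont_on_cyl_const|].
        apply cont_on_cyl_static, cont_on_coord; auto.
    + intros i j Hi Hj.
      replace (fun y => sg * (Hu y t i j - HU y i j) - 2 * e * kronecker i j) with
        (fun y => sg * (Hu y t i j + -1 * HU y i j) + -2 * e * kronecker i j) by (extensionality y; ring).
      apply (slice (fun y s => sg * (Hu y s i j + -1 * HU y i j) + -2 * e * kronecker i j)).
      apply (cont_on_cyl_plus n _ (fun y s => sg * (Hu y s i j + -1 * HU y i j)) (fun _ _ => -2 * e * kronecker i j));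
        [|apply cont_on_cyl_const].
      apply (cont_on_cyl_mult n _ (fun _ _ => sg)); [apply cont_on_cyl_const|].
      apply (cont_on_cyl_plus n _ (fun y s => Hu y s i j)); auto.
      apply (cont_on_cyl_mult n _ (fun _ _ => -1) (fun x _ => HU x i j)); [apply cont_on_cyl_const|].
      apply cont_on_cyl_static; auto.
    + intros i j Hi Hj; rewrite symH, symHU by auto; unfold kronecker.
      rewrite Nat.eqb_sym; auto.
Qed.

(** * Estimates of [Em] at a touching point *)

Lemma psd_block n s M : 0 <= s -> psd n M -> psd (S n) (block s M).
Proof.
  intros Hs HM x; specialize (HM (fun i => x (S i))); unfold qform in *.
  rewrite sumR_succ_l, sumR_succ_l.
  rewrite (sumR_0 n (fun i => block s M 0%nat (S i) * x 0%nat * x (S i))) by (intros; simpl; ring).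
  rewrite (sumR_ext n _ (fun i => sumR n (fun j => M i j * x (S i) * x (S j)))).
  - assert (0 <= x 0%nat * x 0%nat) by nra; simpl; nra.
  - intros i Hi; rewrite sumR_succ_l; simpl; ring.
Qed.

(** The two blocks differ by [block (s' - s) (N - M)], which is positive semidefinite. Read with
    [s = - u_t], this is the parabolicity of [E_m] on the cone. *)
Lemma k_positive_block_add n m s s' M N : (m <= n)%nat -> symmetric n M -> symmetric n N ->
  s <= s' -> psd n (fun i j => N i j - M i j) -> k_positive (S n) m (block s M) ->
  k_positive (S n) m (block s' N) /\ Tp (S n) m (block s M) <= Tp (S n) m (block s' N).
Proof.
  intros Hm HM HN Hs HP HK.
  destruct (k_positive_add_psd (S n) m (block s M) (block (s' - s) (fun i j => N i j - M i j)))
    as [K T]; auto.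
  - apply symmetric_block; auto.
  - apply symmetric_block; intros i j Hi Hj; rewrite HM, HN; auto.
  - apply psd_block; auto; lra.
  - assert (E : forall p, Tp (S n) p (fun i j => block s M i j + block (s' - s) (fun i j => N i j - M i j) i j)
        = Tp (S n) p (block s' N)).
    { intros p; apply Tp_ext; intros [|i] [|j] _ _; simpl; ring. }
    split; [intros p Hp1 Hp; rewrite <- E; auto|rewrite <- E; auto].
Qed.

Lemma pow_le_antitone a p q : 0 <= a <= 1 -> (p <= q)%nat -> a ^ q <= a ^ p.
Proof.
  intros Ha Hpq; replace q with (p + (q - p))%nat by lia; rewrite pow_add.
  assert (H1 : 0 <= a ^ p) by (apply pow_le; lra).
  assert (H2 : a ^ (q - p) <= 1).
  { rewrite <- (pow1 (q - p)); apply pow_incr; lra. }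
  nra.
Qed.

(** The cone is supplied by [S0]: in each degree [p <= m] the shift by [a] gains [a^p >= a^m] and
    the entry [- beta] loses at most [beta * B <= a^m / 2]. Thus [block (- beta) S1] lies in the
    cone, and monotonicity passes from it to [block (- ut) H]. *)
Lemma lower_barrier_Em n m H S0 ut beta a B : (1 <= m)%nat -> (m <= n)%nat ->
  symmetric n H -> symmetric n S0 -> k_positive n m S0 -> 0 < a <= 1 -> 0 <= beta ->
  (forall p, (p < m)%nat -> Tp n p (fun i j => S0 i j + (if Nat.eqb i j then a else 0)) <= B) ->
  beta * B <= a ^ m / 2 -> ut <= beta ->
  psd n (fun i j => H i j - S0 i j - a * kronecker i j) ->
  Tp n m S0 + a ^ m / 2 <= Em n m ut H.
Proof.
  intros Hm Hmn HH HS HK Ha Hb HB HbB Hut HP.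
  pose (S1 := fun i j => S0 i j + (if Nat.eqb i j then a else 0)).
  assert (low : forall p, (1 <= p)%nat -> (p <= m)%nat ->
    Tp n p S0 + a ^ m / 2 <= Tp (S n) p (block (- beta) S1)).
  { intros p Hp1 Hp; assert (H1 := @MinorSums.Tp_shift_ge n p S0 a ltac:(lra) Hp1 ltac:(lia)).
    assert (H2 : Tp n p S0 + a ^ p <= Tp n p S1).
    { apply H1; intros j Hj; apply Rlt_le, (k_positive_0 n m); auto; lia. }
    assert (H3 := pow_le_antitone a p m ltac:(lra) Hp).
    destruct p as [|p]; [lia|]; rewrite Tp_block.
    specialize (HB p ltac:(lia)); fold S1 in HB.
    assert (beta * Tp n p S1 <= beta * B) by (apply Rmult_le_compat_l; auto); lra. }
  assert (Ham : 0 < a ^ m) by (apply pow_lt; lra).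
  rewrite Em_block by auto; apply Rle_trans with (Tp (S n) m (block (- beta) S1)); [apply low; auto|].
  apply (k_positive_block_add n m); auto.
  - intros i j Hi Hj; unfold S1; rewrite HS, Nat.eqb_sym; auto.
  - lra.
  - intros x; specialize (HP x).
    replace (qform n (fun i j => H i j - S1 i j) x) with
      (qform n (fun i j => H i j - S0 i j - a * kronecker i j) x); auto.
    apply sumR_ext; intros i _; apply sumR_ext; intros j _; unfold S1, kronecker.
    destruct (Nat.eqb i j); ring.
  - intros p Hp1 Hp; assert (H1 := low p Hp1 Hp); assert (H2 := HK p Hp1 Hp); lra.
Qed.

(** Here the cone is supplied by the evolution: monotonicity passes from [block (- ut) H] up to
    [block beta S1], and removing the extra coordinate leaves [S1] in [K_(m-1)]. This is just enough
    for the shift inequality from [S1] to [S0] in degree [m]. *)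
Lemma upper_barrier_Em n m H S0 ut beta a B : (1 <= m)%nat -> (m <= n)%nat ->
  symmetric n H -> symmetric n S0 -> k_positive n (m - 1) H -> 0 < Em n m ut H ->
  0 < a <= 1 -> 0 <= beta -> (forall p, (p < m)%nat -> Tp n p S0 <= B) ->
  beta * B <= a ^ m / 2 -> - ut <= beta ->
  psd n (fun i j => S0 i j - H i j - a * kronecker i j) ->
  Em n m ut H <= Tp n m S0 - a ^ m / 2.
Proof.
  intros Hm Hmn HH HS HK HE Ha Hb HB HbB Hut HP.
  pose (S1 := fun i j => S0 i j - a * kronecker i j).
  assert (symS1 : symmetric n S1).
  { intros i j Hi Hj; unfold S1, kronecker; rewrite HS, Nat.eqb_sym; auto. }
  rewrite Em_block in * by auto.
  destruct (k_positive_block_add n m (- ut) beta H S1) as [K T]; auto.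
  - intros x; specialize (HP x).
    replace (qform n (fun i j => S1 i j - H i j) x) with
      (qform n (fun i j => S0 i j - H i j - a * kronecker i j) x); auto.
    apply sumR_ext; intros i _; apply sumR_ext; intros j _; unfold S1; ring.
  - apply k_positive_block; auto.
  - assert (K1 := k_positive_unblock n m beta S1 symS1 Hmn K).
    assert (shift : forall p, (1 <= p)%nat -> (p <= m)%nat -> Tp n p S1 + a ^ p <= Tp n p S0).
    { intros p Hp1 Hp; assert (H1 := @MinorSums.Tp_shift_ge n p S1 a ltac:(lra) Hp1 ltac:(lia)).
      rewrite (Tp_ext n p S0 (fun i j => S1 i j + (if Nat.eqb i j then a else 0))).
      - apply H1; intros j Hj; apply Rlt_le, (k_positive_0 n (m - 1)); auto; lia.
      - intros i j _ _; unfold S1, kronecker; destruct (Nat.eqb i j); ring. }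
    assert (H1 := shift m Hm ltac:(lia)).
    destruct m as [|q]; [lia|].
    assert (H2 : Tp n q S1 <= B).
    { apply Rle_trans with (Tp n q S0); [|apply HB; lia].
      destruct q as [|q]; [rewrite !Tp_0; lra|].
      assert (H2 := shift (S q) ltac:(lia) ltac:(lia)).
      assert (0 < a ^ S q) by (apply pow_lt; lra); lra. }
    assert (beta * Tp n q S1 <= beta * B) by (apply Rmult_le_compat_l; auto).
    rewrite Tp_block in T |- *; rewrite Tp_block in T; lra.
Qed.

(** * Uniform constants and convergence *)

Lemma uniform_bound {A} (P : A -> Prop) (g : nat -> A -> R) k :
  (forall p, (p < k)%nat -> exists C, forall x, P x -> Rabs (g p x) <= C) ->
  exists C, 0 <= C /\ forall p x, (p < k)%nat -> P x -> Rabs (g p x) <= C.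
Proof.
  intros H; induction k as [|k IH].
  - exists 0; split; [lra|]; intros; lia.
  - destruct IH as [C1 [HC1 H1]]; [auto|]; destruct (H k) as [C2 H2]; [lia|].
    exists (Rmax C1 C2); assert (m1 := Rmax_l C1 C2); assert (m2 := Rmax_r C1 C2).
    split; [lra|]; intros p x Hp Hx; destruct (Nat.eq_dec p k) as [->|Hpk].
    + specialize (H2 x Hx); lra.
    + specialize (H1 p x ltac:(lia) Hx); lra.
Qed.

(** The shift [c] covers both barriers: the lower one needs bounds for the Hessian of [U] raised by
    [a], the upper one for the Hessian itself. *)
Lemma Tp_uniform_bound n k Omega HU c : is_bounded n Omega ->
  (forall i j, (i < n)%nat -> (j < n)%nat -> cont_on n (closure_n n Omega) (fun x => HU x i j)) ->
  exists B, 0 <= B /\ forall p x, (p < k)%nat -> closure_n n Omega x ->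
    Rabs (Tp n p (fun i j => HU x i j + (if Nat.eqb i j then c else 0))) <= B.
Proof.
  intros HB cHU.
  destruct (uniform_bound (closure_n n Omega)
    (fun i x => sumR n (fun j => Rabs (HU x i j))) n) as [C [HC H1]].
  { intros i Hi.
    destruct (uniform_bound (closure_n n Omega) (fun j x => HU x i j) n) as [D [HD HD1]].
    - intros j Hj; destruct (cylinder_bounded n Omega (fun x _ => HU x i j) 0 0 HB) as [C HC]; try lra.
      + apply cont_on_cyl_static; auto.
      + exists C; intros x Hx; apply (HC x 0); auto; lra.
    - exists (sumR n (fun _ => D)); intros x Hx.
      rewrite Rabs_right by (apply Rle_ge, sumR_ge0; intros; apply Rabs_pos).
      apply sumR_le; auto. }
  apply uniform_bound; intros p Hp; destruct (Tp_bounded n p (C + Rabs c)) as [B [_ HT]].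
  exists B; intros x Hx; apply HT; intros i j Hi Hj.
  eapply Rle_trans; [apply Rabs_triang|]; apply Rplus_le_compat.
  - apply Rle_trans with (sumR n (fun j => Rabs (HU x i j))).
    + apply (term_le_sumR n (fun j => Rabs (HU x i j))); auto; intros; apply Rabs_pos.
    + eapply Rle_trans; [apply Rle_abs|]; auto.
  - destruct (Nat.eqb i j); [lra|rewrite Rabs_R0; apply Rabs_pos].
Qed.

(** Transfers the positivity assumed for [phi] at [x0] to the Hessian of [u] at time 0, where the
    continuation in time starts. *)
Lemma initial_hessian n Omega phi u Hu Ut Hphi x0 : is_open n Omega ->
  C21_bar n Omega u Hu Ut -> C2_on n Omega Omega (fun x => phi x 0) Hphi ->
  (forall x, Omega x -> u x 0 = phi x 0) -> Omega x0 ->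
  forall i j, (i < n)%nat -> (j < n)%nat -> Hu x0 0 i j = Hphi x0 i j.
Proof.
  intros HO [Du [Du1 [Du2 [Du3 [cu [cDu [cHu cUt]]]]]]] [Dp [Dp1 [Dp2 _]]] E Hx0 i j Hi Hj.
  assert (EDu : forall y k, Omega y -> (k < n)%nat -> Du k y 0 = Dp k y).
  { intros y k Hy Hk.
    apply (has_partial_unique n Omega (fun y => u y 0) (fun y => phi y 0) k y); auto.
    apply (has_partial_initial n Omega u (Du k)); auto. }
  apply (has_partial_unique n Omega (fun y => Du j y 0) (Dp j) i x0); auto.
  apply (has_partial_initial n Omega (Du j) (fun y t => Hu y t i j)); auto.
Qed.

(** The margin 1 makes [e * (R2 - sqnorm n x)] at least [e], which absorbs a boundary error of size
    [e]. *)
Lemma sqnorm_closure_bound n Omega : is_bounded n Omega ->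
  exists R2, 0 < R2 /\ forall x, closure_n n Omega x -> 0 <= sqnorm n x <= R2 - 1.
Proof.
  intros HB; destruct (cylinder_bounded n Omega (fun x _ => sqnorm n x) 0 0 HB) as [C HC]; try lra.
  { apply cont_on_cyl_sqnorm. }
  assert (a := Rabs_pos C); assert (b := Rle_abs C).
  exists (Rabs C + 1); split; [lra|]; intros x Hx; split.
  - apply sumR_ge0; intros; nra.
  - specialize (HC x 0 Hx ltac:(lra)); assert (c := Rle_abs (sqnorm n x)); lra.
Qed.

(** From [exp y >= 1 + y], with [T0] chosen so that [lam * (t - T)] is at least [C / eps] from then
    on. *)
Lemma exp_decay C lam eps T : 0 <= C -> 0 < lam -> 0 < eps ->
  exists T0, T <= T0 /\ forall t, T0 <= t -> C * exp (- lam * (t - T)) <= eps.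
Proof.
  intros HC Hl He; exists (T + C / (lam * eps)).
  assert (Hle : 0 < lam * eps) by (apply Rmult_lt_0_compat; auto).
  assert (Hq : 0 <= C / (lam * eps)).
  { apply Rmult_le_pos; auto; apply Rlt_le, Rinv_0_lt_compat; auto. }
  split; [lra|]; intros t Ht.
  replace (- lam * (t - T)) with (- (lam * (t - T))) by ring; rewrite exp_Ropp.
  assert (Hz : C / eps <= lam * (t - T)).
  { replace (C / eps) with (lam * (C / (lam * eps))) by (field; lra).
    apply Rmult_le_compat_l; lra. }
  assert (He1 : C / eps <= exp (lam * (t - T))).
  { assert (H0 : 0 <= lam * (t - T)) by (apply Rmult_le_pos; lra).
    assert (H := exp_ineq1_le (lam * (t - T))); lra. }
  assert (Hp := exp_pos (lam * (t - T))).
  apply Rmult_le_reg_r with (exp (lam * (t - T))); auto.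
  rewrite Rmult_assoc, Rinv_l, Rmult_1_r by lra.
  apply Rmult_le_compat_l with (r := eps) in He1; [|lra].
  replace (eps * (C / eps)) with C in He1 by (field; lra); auto.
Qed.

Theorem theorem3p1 (n m : nat) (Omega : Rn -> Prop)
  (f : Rn -> R -> R) (phi : Rn -> R -> R) (ff : Rn -> R) (Phi : Rn -> R) :
  is_domain n Omega -> is_bounded n Omega ->
  (1 <= m)%nat -> (m <= n)%nat ->
  cont_on n (closure_n n Omega) ff ->
  cont_on n (boundary_n n Omega) Phi ->
  (* (i) *)
  (exists nu, 0 < nu /\ forall x t, closure_n n Omega x -> 0 <= t -> nu <= f x t) ->
  (exists Hphi : Rn -> Mat, C2_on n Omega Omega (fun x => phi x 0) Hphi /\
     exists x0, Omega x0 /\ k_positive n (m - 1) (Hphi x0)) ->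
  (* (iv) *)
  (forall eps, 0 < eps -> exists T0, forall t x, T0 <= t -> closure_n n Omega x ->
       Rabs (f x t - ff x) <= eps) ->
  (forall eps, 0 < eps -> exists T0, forall t x, T0 <= t -> boundary_n n Omega x ->
       Rabs (phi x t - Phi x) <= eps) ->
  (* (ii) *)
  forall (u : Rn -> R -> R) (Hu : Rn -> R -> Mat) (Ut : Rn -> R -> R),
  C21_bar n Omega u Hu Ut ->
  (forall x t, Omega x -> 0 < t -> Em n m (Ut x t) (Hu x t) = f x t) ->
  (forall x, Omega x -> u x 0 = phi x 0) ->
  (forall x t, boundary_n n Omega x -> 0 <= t -> u x t = phi x t) ->
  (* (iii) *)
  forall (U : Rn -> R) (HU : Rn -> Mat),
  C2_on n Omega (closure_n n Omega) U HU ->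
  (forall x, closure_n n Omega x -> k_positive n m (HU x)) ->
  (forall x, Omega x -> Tp n m (HU x) = ff x) ->
  (forall x, boundary_n n Omega x -> U x = Phi x) ->
  (* conclusion *)
  forall eps, 0 < eps -> exists T0, forall t x, T0 <= t -> closure_n n Omega x ->
    Rabs (u x t - U x) <= eps.
Proof.
  intros [HO [Hconn _]] HB Hm Hmn _ _ [nu [Hnu Hf]] [Hphi [C2phi [x0 [Hx0 Hadm0]]]] Hlimf Hlimphi
    u Hu Ut C21 HE Hinit Hbdry U HU C2U HadmU HTU HbdryU eps Heps.
  assert (HCl : forall y, Omega y -> closure_n n Omega y) by (intros; apply closure_incl; auto).
  assert (adm : forall x t, Omega x -> 0 < t -> k_positive n (m - 1) (Hu x t)).
  { assert (C21' := C21); destruct C21' as [Du [Du1 [Du2 [_ [_ [_ [cHu cUt]]]]]]].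
    apply (admissible_everywhere n m Omega Hu Ut nu) with x0; auto.
    - intros x t Hx Ht; apply (hessian_symmetric n Omega (fun y => u y t) (fun i y => Du i y t) (fun y => Hu y t)); auto.
      intros i j Hi Hj; apply (cyl_slice n Omega (closure_n n Omega) (fun y t => Hu y t i j)); auto; lra.
    - intros x t Hx Ht; rewrite HE by auto; apply Hf; auto; lra.
    - intros p Hp1 Hp; rewrite (Tp_ext n p _ (Hphi x0)); auto.
      apply (initial_hessian n Omega phi u Hu Ut); auto. }
  destruct (sqnorm_closure_bound n Omega HB) as [R2 [HR2 Hsq]].
  (* The first bound gives [2 * e <= 1], as the barrier estimates require; the second keeps the
     quadratic part of the barrier below [eps / 2]. *)
  set (e := Rmin (1 / 2) (eps / (2 * R2))).
  assert (e1 : e <= 1 / 2) by apply Rmin_l.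
  assert (e2 : e <= eps / (2 * R2)) by apply Rmin_r.
  assert (e0 : 0 < e) by (apply Rmin_pos; [lra|apply Rdiv_lt_0_compat; lra]).
  assert (eR2 : e * R2 <= eps / 2).
  { replace (eps / 2) with (eps / (2 * R2) * R2) by (field; lra).
    apply Rmult_le_compat_r; lra. }
  (* The Hessian of [e * sqnorm] is [2 e] times the identity. *)
  pose (a := 2 * e); assert (Ha : 0 < a <= 1) by (unfold a; lra).
  assert (Ham : 0 < a ^ m) by (apply pow_lt; lra).
  assert (cHU : forall i j, (i < n)%nat -> (j < n)%nat ->
    cont_on n (closure_n n Omega) (fun x => HU x i j)) by (destruct C2U as [DU HDU]; apply HDU).
  destruct (Tp_uniform_bound n m Omega HU a HB cHU) as [B1 [HB1 bound1]].
  destruct (Tp_uniform_bound n m Omega HU 0 HB cHU) as [B2 [HB2 bound2]].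
  assert (bound2' : forall p x, (p < m)%nat -> closure_n n Omega x -> Tp n p (HU x) <= B1 + B2).
  { intros p x Hp Hx; specialize (bound2 p x Hp Hx).
    rewrite (Tp_ext n p _ (HU x)) in bound2 by (intros i j _ _; destruct (Nat.eqb i j); ring).
    assert (h := Rle_abs (Tp n p (HU x))); lra. }
  (* Strictly below the gap [a^m / 2] that the barrier estimates produce, so that they contradict
     the equations for [u] and [U]. *)
  destruct (Hlimf (a ^ m / 4)) as [T1 HT1]; [lra|].
  destruct (Hlimphi e e0) as [T2 HT2].
  pose (T := Rmax 0 (Rmax T1 T2)).
  assert (TT : 0 <= T /\ T1 <= T /\ T2 <= T).
  { unfold T; assert (h1 := Rmax_l 0 (Rmax T1 T2)); assert (h2 := Rmax_r 0 (Rmax T1 T2)).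
    assert (h3 := Rmax_l T1 T2); assert (h4 := Rmax_r T1 T2); lra. }
  destruct TT as [TT0 [TT1 TT2]].
  assert (cu : cont_on_cyl n (closure_n n Omega) (fun x t => u x t + -1 * U x)).
  { apply (cont_on_cyl_plus n _ u); [destruct C21 as [Du HDu]; apply HDu|].
    apply (cont_on_cyl_mult n _ (fun _ _ => -1) (fun x _ => U x)); [apply cont_on_cyl_const|].
    apply cont_on_cyl_static; destruct C2U as [DU HDU]; apply HDU. }
  destruct (cylinder_bounded n Omega _ T T HB TT0 (Rle_refl T) cu) as [C0 HC0].
  pose (C := Rabs C0).
  assert (HC : 0 <= C) by apply Rabs_pos.
  assert (HCu : forall x, closure_n n Omega x -> Rabs (u x T + -1 * U x) <= C).
  { intros x Hx; eapply Rle_trans; [apply (HC0 x T Hx); lra|apply Rle_abs]. }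
  (* Small enough that the speed [C * lam] of the barrier, times the bound on the [T_p], stays below
     [a^m / 2]; the summand 1 guards against a zero denominator. *)
  pose (lam := a ^ m / (2 * (C * (B1 + B2) + 1))).
  assert (HCB : 0 <= C * (B1 + B2)) by (apply Rmult_le_pos; lra).
  assert (Hlam : 0 < lam) by (apply Rdiv_lt_0_compat; lra).
  assert (HlamC : C * lam * (B1 + B2) <= a ^ m / 2).
  { replace (C * lam * (B1 + B2)) with (lam * (C * (B1 + B2))) by ring.
    replace (a ^ m / 2) with (lam * (C * (B1 + B2) + 1)) by (unfold lam; field; lra).
    apply Rmult_le_compat_l; lra. }
  pose (w := fun sg x t => sg * (u x t + -1 * U x) +
    (e * (R2 + -1 * sqnorm n x) + C * exp (- lam * (t - T)))).
  assert (w_ge0 : forall sg, sg = 1 \/ sg = -1 -> forall x t, closure_n n Omega x -> T <= t -> 0 <= w sg x t).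
  { intros sg Hsg x1 t1 Hx1 Ht1; apply Rnot_lt_le; intros Hneg.
    destruct (touching_point n Omega u Hu Ut U HU sg e R2 C lam T x1 t1)
      as [x [t [Hx [Ht [Hw_t [symH [symHU HP]]]]]]]; auto.
    - intros x Hx; rewrite Rminus_diag, Rmult_0_r, exp_0.
      assert (h := HCu x Hx); assert (hs := Hsq x Hx).
      assert (h1 := Rle_abs (u x T + -1 * U x)); assert (h2 := Rle_abs (- (u x T + -1 * U x))).
      rewrite Rabs_Ropp in h2; destruct Hsg as [-> | ->]; nra.
    - intros x t Hx Ht; rewrite (Hbdry x t Hx), (HbdryU x Hx) by lra.
      assert (h := HT2 t x ltac:(lra) Hx); assert (hs := Hsq x (proj1 Hx)).
      assert (h1 := Rle_abs (phi x t - Phi x)); assert (h2 := Rle_abs (- (phi x t - Phi x))).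
      rewrite Rabs_Ropp in h2.
      assert (0 <= C * exp (- lam * (t - T))) by (apply Rmult_le_pos; auto; apply Rlt_le, exp_pos).
      destruct Hsg as [-> | ->]; nra.
    - assert (Hexp : 0 < exp (- lam * (t - T)) <= 1).
      { split; [apply exp_pos|]; rewrite <- exp_0; destruct (Rle_lt_or_eq_dec (- lam * (t - T)) 0) as [h|h].
        - nra.
        - apply Rlt_le, exp_increasing; auto.
        - rewrite h; lra. }
      set (beta := C * lam * exp (- lam * (t - T))) in *.
      assert (HClam : 0 <= C * lam) by (apply Rmult_le_pos; lra).
      assert (Hbeta : 0 <= beta) by (apply Rmult_le_pos; lra).
      assert (HbB : beta * (B1 + B2) <= a ^ m / 2).
      { apply Rle_trans with (C * lam * (B1 + B2)); auto.
        apply Rmult_le_compat_r; [lra|]; unfold beta; nra. }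
      assert (hf := HT1 t x ltac:(lra) (HCl x Hx)).
      assert (h1 := Rle_abs (f x t - ff x)); assert (h2 := Rle_abs (- (f x t - ff x))).
      rewrite Rabs_Ropp in h2.
      assert (HEx := HE x t Hx ltac:(lra)).
      assert (HTx := HTU x Hx).
      destruct Hsg as [-> | ->].
      + assert (L := lower_barrier_Em n m (Hu x t) (HU x) (Ut x t) beta a (B1 + B2) Hm Hmn symH symHU
          (HadmU x (HCl x Hx)) Ha Hbeta).
        assert (Tp n m (HU x) + a ^ m / 2 <= Em n m (Ut x t) (Hu x t)); [|lra].
        apply L; auto; [|lra|].
        * intros p Hp; specialize (bound1 p x Hp (HCl x Hx)).
          eapply Rle_trans; [apply Rle_abs|]; lra.
        * intros y; specialize (HP y).
          replace (qform n (fun i j => Hu x t i j - HU x i j - a * kronecker i j) y) with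
            (qform n (fun i j => 1 * (Hu x t i j - HU x i j) - 2 * e * kronecker i j) y); auto.
          apply sumR_ext; intros i _; apply sumR_ext; intros j _; unfold a; ring.
      + assert (L := upper_barrier_Em n m (Hu x t) (HU x) (Ut x t) beta a (B1 + B2) Hm Hmn symH symHU
          (adm x t Hx ltac:(lra))).
        assert (Em n m (Ut x t) (Hu x t) <= Tp n m (HU x) - a ^ m / 2); [|lra].
        apply L; auto; [|lra|].
        * rewrite HEx; assert (h := Hf x t (HCl x Hx) ltac:(lra)); lra.
        * intros y; specialize (HP y).
          replace (qform n (fun i j => HU x i j - Hu x t i j - a * kronecker i j) y) with
            (qform n (fun i j => -1 * (Hu x t i j - HU x i j) - 2 * e * kronecker i j) y); auto.
          apply sumR_ext; intros i _; apply sumR_ext; intros j _; unfold a; ring. }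
  destruct (exp_decay C lam (eps / 2) T HC Hlam) as [T0 [HT0 Hdecay]]; [lra|].
  exists T0; intros t x Ht Hx.
  (* Together the two signs bound [|u - U|] by the quadratic part plus the exponential part, each at
     most [eps / 2]. *)
  assert (w1 := w_ge0 1 ltac:(auto) x t Hx ltac:(lra)).
  assert (w2 := w_ge0 (-1) ltac:(auto) x t Hx ltac:(lra)).
  specialize (Hdecay t Ht); assert (hs := Hsq x Hx); unfold w in w1, w2.
  assert (e * (R2 + -1 * sqnorm n x) <= e * R2) by nra.
  apply Rabs_le; lra.
Qed.
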